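(* Let $P$ be a convex $d$-polytope ($d \geq 1$) and let $0 \leq k \leq d-1$. Then \[ \frac{f_k(P)}{f_0(P)} \geq \rho(d, k) \qquad\text{and}\qquad \frac{f_k(P)}{f_{d-1}(P)} \geq \rho(d, d-k-1). \] In the first inequality, equality holds if and only if $k=0$, or $k=1$ and $P$ is simple. In the second inequality, equality holds if and only if $k=d-1$, or $k=d-2$ and $P$ is simplicial.
   Context: For a polytope $P$, $f_k(P)$ denotes the number of $k$-dimensional faces of $P$. For integers $0 \leq k < d$, define \[ \rho(d, k) = \frac{1}{2}\left[\binom{\lceil d/2 \rceil}{k} + \binom{\lfloor d/2 \rfloor}{k}\right]. \] *)

(* Defs.v *)
From mathcomp Require Import all_boot all_order all_algebra.
From mathcomp Require Import finmap.
From mathcomp Require Import boolp classical_sets cardinality reals convex.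

Set Implicit Arguments.
Unset Strict Implicit.
Unset Printing Implicit Defensive.

Import Order.TTheory GRing.Theory Num.Theory.

Local Open Scope classical_set_scope.
Local Open Scope ring_scope.

Definition rho (d k : nat) : rat :=
  2^-1 * ('C(uphalf d, k)%:R + 'C(d./2, k)%:R).

Section Polytopes.
Variables (R : realType) (n : nat).
Local Notation V := 'rV[R]_n.
Implicit Types (A F G P S : set V) (d k : nat).

Definition convex_hull A : set V := smallest (@convex_set R V) A.

(* The empty set is affine, so that [affine_hull set0 = set0]. *)
Definition affine_set A : Prop :=
  forall (x y : V) (t : R), A x -> A y -> A (t *: x + (1 - t) *: y).

Definition affine_hull A : set V := smallest affine_set A.

(* A relation rather than a function to nat: the empty set (of dimension -1 by
   convention) is related to no natural number. *)
Definition has_dim A k : Prop :=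
  exists (x : V) (U : {vspace V}),
    \dim U = k /\ affine_hull A = [set x + u | u in [set` U]].

Definition polytope P : Prop := exists s : seq V, P = convex_hull [set` s].

Definition d_polytope d P : Prop := polytope P /\ has_dim P d.

(* The column vector [c] stands for the linear functional [x |-> x *m c]. With
   [c = 0], both [P] itself ([b = 0]) and [set0] ([b = 1]) are faces of [P]. *)
Definition face P F : Prop :=
  exists (c : 'cV[R]_n) (b : R),
    (forall x, P x -> (x *m c) 0 0 <= b) /\
    F = P `&` [set x | (x *m c) 0 0 = b].

Definition faces P k : set (set V) := [set F | face P F /\ has_dim F k].

(* [fset_set] sends infinite sets to the empty one; a polytope has finitely
   many faces. *)
Definition fnum P k : nat := #|` fset_set (faces P k)|%fset.

Definition affinely_independent (m : nat) (p : 'I_m -> V) : Prop :=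
  forall w : 'I_m -> R,
    \sum_i w i = 0 -> \sum_i w i *: p i = 0 -> forall i, w i = 0.

Definition simplex S : Prop :=
  exists (m : nat) (p : 'I_m -> V),
    affinely_independent p /\ S = convex_hull (range p).

(* For a [d]-polytope with [d >= 1], the facets are the elements of
   [faces P d.-1] and the vertices those of [faces P 0]. *)
Definition simple d P : Prop :=
  forall F, faces P 0 F ->
    #|` fset_set [set G | faces P d.-1 G /\ F `<=` G]%classic|%fset = d.

Definition simplicial d P : Prop := forall G, faces P d.-1 G -> simplex G.

End Polytopes.

(* Main.v *)
(** Let h be a generic linear functional and v a vertex of P.  The linear
    functionals y that are nonnegative on the cone of P at v, and remain so after
    adding h, form a pointed polyhedron; at one of its vertices y, the faces of P
    on which y, resp. y + h, vanishes have dimensions a and b with a + b >= d.  On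
    the first v is the lowest point for h, on the second the highest.  An
    a-dimensional face has at least C(a, k) k-faces at each of its vertices, so at
    least C(a, k) + C(b, k) k-faces have v as their lowest or highest point, and
    by convexity this is at least 2 rho(d, k).  Every k-face has one lowest and
    one highest point, whence the first inequality.  For the equality cases,
    choose h so that v is the highest point of P.

    The argument only uses the homogenised points (p, 1) and the linear
    functionals that are nonnegative on them.  The facet normals form a point
    configuration of the same kind, whose face lattice is the opposite one, so the
    second inequality is the first one for that dual configuration. *)
Require Import Defs.
From mathcomp Require Import all_boot all_order all_algebra.
From mathcomp Require Import boolp ring lra zify.

Set Implicit Arguments.
Unset Strict Implicit.
Unset Printing Implicit Defensive.

Import Order.TTheory GRing.Theory Num.Theory.

(** * Face lattices *)

(* [zify] explodes on boolean hypotheses that are not arithmetic. *)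
Ltac slia :=
  repeat match goal with
  | H : is_true ?b |- _ => lazymatch b with leq _ _ => fail | _ => clear H end
  end; lia.

Section FaceSystem.
Variable T : finType.
Implicit Types (I J L G E : {set T}) (face : pred {set T}) (rk : {set T} -> nat).

(** [face_split] stands in for the diamond property: a face of corank at least two in [J] is the
    intersection of two strictly larger proper subfaces of [J]. Coatoms of the expected rank come
    from it. *)
Record face_system face rk : Prop := FaceSystem {
  faceI : forall I J, face I -> face J -> face (I :&: J);
  rk_proper : forall I J, face I -> face J -> I \proper J -> (rk I < rk J)%N;
  face_split : forall I J, face I -> face J -> I \proper J -> (rk I + 2 <= rk J)%N ->
    exists I1 I2, [/\ face I1 /\ face I2, I \proper I1, I \proper I2,
                      I1 \proper J /\ I2 \proper J & I1 :&: I2 = I]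
}.

Definition interval face rk I J r :=
  [set L | [&& face L, I \subset L, L \subset J & rk L == r]].

Variables (face : pred {set T}) (rk : {set T} -> nat).
Hypothesis fs : face_system face rk.

Local Notation itv := (interval face rk).

Lemma rk_sub I J : face I -> face J -> I \subset J -> (rk I <= rk J)%N.
Proof.
move=> fI fJ; rewrite subEproper => /orP[/eqP->//|IJ].
exact: ltnW (rk_proper fs fI fJ IJ).
Qed.

Lemma face_eq_rk I J : face I -> face J -> I \subset J -> (rk J <= rk I)%N -> I = J.
Proof.
move=> fI fJ; rewrite subEproper => /orP[/eqP->//|IJ].
by rewrite leqNgt (rk_proper fs fI fJ IJ).
Qed.

(** While the corank is at least two, [I] splits as an intersection of two larger faces, one of
    which still misses [x]. Hence [I] is the intersection of the coatoms above it. *)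
Lemma coatom_avoiding I J x : face I -> face J -> I \subset J -> x \in J -> x \notin I ->
  exists2 G, G \in itv I J (rk J).-1 & x \notin G.
Proof.
move=> fI fJ; move: {2}(rk J - rk I)%N (leqnn (rk J - rk I)) => r.
elim: r I fI => [|r IH] I fI hr IJ xJ xI.
  have e : I = J by apply: face_eq_rk => //; slia.
  by rewrite e xJ in xI.
have pIJ : I \proper J by apply/properP; split=> //; exists x.
have := rk_proper fs fI fJ pIJ; rewrite leq_eqVlt => /orP[/eqP e|r2].
  by exists I => //; rewrite inE fI subxx IJ -e /= eqxx.
have [I1 [I2 [[f1 f2] p1 p2 [q1 q2] e]]] := face_split fs fI fJ pIJ (ltac:(slia)).
have : x \notin I1 :&: I2 by rewrite e.
have aux I' : face I' -> I \proper I' -> I' \proper J -> x \notin I' ->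
    exists2 G, G \in itv I J (rk J).-1 & x \notin G.
  move=> f' p' q' x'; have := rk_proper fs fI f' p' => lt.
  have [|G] := IH I' f' _ (proper_sub q') xJ x'; first by slia.
  rewrite inE => /and4P[fG IG GJ rG] xG; exists G => //.
  by rewrite inE fG GJ rG (subset_trans (proper_sub p') IG).
by rewrite inE negb_and => /orP[]; apply: aux.
Qed.

(* Otherwise [G] would be the only coatom of [I, J], whereas [I] is an
   intersection of coatoms. *)
Lemma atom_avoiding I J G : face I -> face J -> face G ->
  I \subset G -> G \proper J -> exists2 E, E \in itv I J (rk I).+1 & ~~ (E \subset G).
Proof.
move=> fI; move: {2}(rk J) (leqnn (rk J)) => r.
elim: r J G => [|r IH] J G hr fJ fG IG GJ.
  by have := rk_proper fs fG fJ GJ; slia.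
have rGJ := rk_proper fs fG fJ GJ.
have IJ : I \subset J := subset_trans IG (proper_sub GJ).
have rIG := rk_sub fI fG IG.
have [e|/eqP ne] := eqVneq (rk J) (rk I).+1.
  exists J; last first.
    move: GJ => /properP[_ [y yJ yG]].
    by apply/negP => /subsetP/(_ _ yJ); rewrite (negPf yG).
  by rewrite inE fJ IJ subxx e /= eqxx.
suff [J' J'I J'G] : exists2 J', J' \in itv I J (rk J).-1 & ~~ (J' \subset G).
  move: J'I; rewrite inE => /and4P[fJ' IJ' J'J /eqP rJ'].
  have fJG := faceI fs fJ' fG.
  have pJG : J' :&: G \proper J' by rewrite properE subsetIl subsetI subxx.
  have [||E] := IH J' (J' :&: G) _ fJ' fJG _ pJG; first by slia.
    by rewrite subsetI IJ'.
  rewrite inE => /and4P[fE IE EJ' rE] EG; exists E.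
    by rewrite inE fE IE rE (subset_trans EJ' J'J).
  by apply: contra EG => EG; rewrite subsetI EJ'.
have [_ [y yJ yG]] := properP GJ.
have yI : y \notin I by apply: contra yG; apply/subsetP.
have [G1 G1I yG1] := coatom_avoiding fI fJ IJ yJ yI.
have [sG|?] := boolP (G1 \subset G); last by exists G1.
move: (G1I); rewrite inE => /and4P[fG1 IG1 G1J /eqP rG1].
have eG : G1 = G by apply: face_eq_rk => //; slia.
have pIG : ~~ (G \subset I).
  by apply/negP => /(rk_sub fG fI); move: rG1; rewrite eG; slia.
have /subsetPn[x xG xI] := pIG.
have [G2 G2I xG2] := coatom_avoiding fI fJ IJ (subsetP (proper_sub GJ) _ xG) xI.
exists G2 => //; apply/negP => sG2.
move: (G2I); rewrite inE => /and4P[fG2 _ _ /eqP rG2].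
have e2 : G2 = G by apply: face_eq_rk => //; rewrite rG2 -rG1 eG.
by rewrite e2 xG in xG2.
Qed.

Lemma proper_coatom I J : face I -> face J -> I \proper J -> exists G, G \in itv I J (rk J).-1.
Proof.
move=> fI fJ /properP[IJ [x xJ xI]].
by have [G GI _] := coatom_avoiding fI fJ IJ xJ xI; exists G.
Qed.

(** Pascal's rule: for a coatom [G] and an atom [E] not below [G], the intervals [[I, G]] and
    [[E, J]] are disjoint and supply the two summands. *)
Lemma interval_bin_le I J k : face I -> face J -> I \subset J ->
  ('C(rk J - rk I, k) <= #|itv I J (rk I + k)|)%N.
Proof.
move: {2}(rk J - rk I)%N (erefl (rk J - rk I)%N) => r.
elim: r I J k => [|r IH] I J [|k] hr fI fJ IJ; rewrite hr ?bin0n ?bin0 //.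
- by rewrite card_gt0; apply/set0Pn; exists I; rewrite inE fI subxx IJ addn0 /=.
- by rewrite card_gt0; apply/set0Pn; exists I; rewrite inE fI subxx IJ addn0 /=.
have pIJ : I \proper J.
  by move: IJ; rewrite subEproper => /orP[/eqP e|//]; rewrite e subnn in hr.
have [G] := proper_coatom fI fJ pIJ.
rewrite inE => /and4P[fG IG GJ /eqP rG].
have pGJ : G \proper J.
  by move: GJ; rewrite subEproper => /orP[/eqP e|//]; rewrite e in rG; slia.
have [E] := atom_avoiding fI fJ fG IG pGJ.
rewrite inE => /and4P[fE IE EJ /eqP rE] EG.
have h1 := IH I G k.+1 (ltac:(slia)) fI fG IG.
have h2 := IH E J k (ltac:(slia)) fE fJ EJ.
have -> : 'C(r.+1, k.+1) = ('C(rk G - rk I, k.+1) + 'C(rk J - rk E, k))%N.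
  by rewrite binS; congr ('C(_, _) + 'C(_, _))%N; slia.
apply: leq_trans (leq_add h1 h2) _.
rewrite -cardsUI [X in (_ + X)%N](_ : _ = 0%N).
  rewrite addn0; apply/subset_leq_card/subsetP => L; rewrite !inE.
  case/orP => /and4P[-> sL Ls /eqP->] /=.
    by rewrite sL (subset_trans Ls GJ) /=.
  by rewrite (subset_trans IE sL) Ls rE /=; slia.
apply/eqP; rewrite cards_eq0; apply/eqP/setP => L; rewrite !inE.
apply/negP => /andP[/and4P[_ _ LG _] /and4P[_ EL _ _]].
by rewrite (subset_trans EL LG) in EG.
Qed.

Lemma card_injective_sets (A : {set {set T}}) (B : {set {set T}}) (f : {set T} -> {set {set T}}) r :
  #|B| = r.+1 -> {in A &, injective f} -> {in A, forall X, f X \subset B /\ #|f X| = r} ->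
  (#|A| <= r.+1)%N.
Proof.
move=> cB inj h; rewrite -(card_in_imset inj).
have := cards_draws B r; rewrite cB binSn => <-.
apply/subset_leq_card/subsetP => _ /imsetP[X XA ->].
by have [s c] := h _ XA; rewrite inE s c eqxx.
Qed.

(* An interval with as few atoms as its rank allows is Boolean. *)
Lemma atoms_coatoms I J r : face I -> face J -> I \subset J -> rk J = (rk I + r)%N ->
  (0 < r)%N -> #|itv I J (rk I).+1| = r <-> #|itv I J (rk J).-1| = r.
Proof.
move=> fI fJ IJ hr; case: r hr => [//|r] hr _.
have ca K L : face K -> face L -> K \subset L -> (rk L - rk K <= #|itv K L (rk K).+1|)%N.
  by move=> fK fL KL; have := interval_bin_le 1 fK fL KL; rewrite bin1 addn1.
have cc K L : face K -> face L -> K \proper L -> (rk L - rk K <= #|itv K L (rk L).-1|)%N.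
  move=> fK fL KL; have lt := rk_proper fs fK fL KL.
  have := interval_bin_le (rk L - rk K).-1 fK fL (proper_sub KL).
  rewrite (_ : rk K + _ = (rk L).-1)%N; last by slia.
  by case e: (rk L - rk K)%N => [|m]; rewrite /= ?binSn //.
have pIJ : I \proper J.
  by move: IJ; rewrite subEproper => /orP[/eqP e|//]; rewrite e in hr; slia.
split=> h; apply/eqP; rewrite eqn_leq; apply/andP; split.
(* Send a coatom to the atoms below it; coatoms with the same atoms coincide. Some atom is not below
   [G], so at most [r] are, and the binomial bound gives at least [r]. The converse sends an atom to
   the coatoms above it. *)
- apply: (card_injective_sets (f := fun G => itv I G (rk I).+1) h).
  + move=> G1 G2; rewrite !inE => /and4P[f1 I1 J1 /eqP r1] /and4P[f2 I2 J2 /eqP r2] e.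
    apply/eqP/negPn/negP => ne.
    have p : G1 :&: G2 \proper G1.
      rewrite properE subsetIl subsetI subxx /=; apply: contra ne => s.
      by apply/eqP/face_eq_rk => //; slia.
    have IG : I \subset G1 :&: G2 by rewrite subsetI I1.
    have [E EI] := atom_avoiding fI f1 (faceI fs f1 f2) IG p.
    move: (EI); rewrite e !inE => /and4P[_ _ EG2 _].
    move: (EI); rewrite !inE => /and4P[_ _ EG1 _].
    by rewrite subsetI EG1 EG2.
  + move=> G; rewrite inE => /and4P[fG IG GJ /eqP rG].
    have pG : G \proper J.
      by move: GJ; rewrite subEproper => /orP[/eqP e|//]; rewrite e in rG; slia.
    have [E EJ EG] := atom_avoiding fI fJ fG IG pG.
    have s : itv I G (rk I).+1 \proper itv I J (rk I).+1.
      apply/properP; split; last by exists E => //; rewrite inE (negPf EG) /= !andbF.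
      apply/subsetP => L; rewrite !inE => /and4P[-> -> s ->].
      by rewrite (subset_trans s GJ).
    split=> /=; first exact: proper_sub.
    have := ca _ _ fI fG IG; rewrite rG hr addnS /= addKn => l.
    by have := proper_card s; rewrite h ltnS => u; apply/eqP; rewrite eqn_leq u l.
- by have := cc _ _ fI fJ pIJ; slia.
- apply: (card_injective_sets (f := fun E => itv E J (rk J).-1) h).
  + move=> E1 E2; rewrite !inE => /and4P[f1 I1 J1 /eqP r1] /and4P[f2 I2 J2 /eqP r2] e.
    apply: face_eq_rk => //; last by slia.
    apply/negPn/negP => ne.
    have /subsetPn[x x1 x2] := ne.
    have [G GI xG] := coatom_avoiding f2 fJ J2 (subsetP J1 _ x1) x2.
    move: GI; rewrite -e !inE => /and4P[_ s _ _].
    by rewrite (subsetP s) in xG.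
  + move=> E; rewrite inE => /and4P[fE IE EJ /eqP rE].
    have /subsetPn[x xE xI] : ~~ (E \subset I).
      by apply/negP => /(rk_sub fE fI); slia.
    have [G GI xG] := coatom_avoiding fI fJ IJ (subsetP EJ _ xE) xI.
    have s : itv E J (rk J).-1 \proper itv I J (rk J).-1.
      apply/properP; split.
        apply/subsetP => L; rewrite !inE => /and4P[-> s -> ->].
        by rewrite (subset_trans IE s).
      exists G => //; rewrite inE; apply/negP => /and4P[_ s _ _].
      by rewrite (subsetP s) in xG.
    split=> /=; first exact: proper_sub.
    have := proper_card s.
    move: EJ; rewrite h subEproper => /orP[/eqP e|].
      have -> : r = 0%N by move: rE; rewrite e hr; lia.
      by rewrite e ltnS leqn0 => /eqP.
    rewrite ltnS => p u; apply/eqP; rewrite eqn_leq u.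
    by have := cc _ _ fE fJ p; rewrite hr rE -addSnnS addKn.
- by have := ca _ _ fI fJ IJ; rewrite hr addKn.
Qed.

(** Going down from [J] to [I] through successive coatoms, [g] grows by at least one per step.
    Applied twice, this determines the rank function of the dual. *)
Lemma strictly_antitone_rk (g : {set T} -> nat) I J : face I -> face J -> I \subset J ->
  (forall K L, face K -> face L -> K \proper L -> (g L < g K)%N) ->
  (g J + (rk J - rk I) <= g I)%N.
Proof.
move=> fI fJ IJ hg; move: {2}(rk J) (leqnn (rk J)) => r.
elim: r J fJ IJ => [|r IH] J fJ IJ hr.
  have := rk_sub fI fJ IJ => h.
  by rewrite (face_eq_rk fI fJ IJ); slia.
move: (IJ); rewrite subEproper => /orP[/eqP->|p]; first by rewrite subnn addn0.
have [G] := proper_coatom fI fJ p; rewrite inE => /and4P[fG IG GJ /eqP rG].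
have lt := rk_proper fs fI fJ p.
have := IH G fG IG (ltac:(slia)).
have pG : G \proper J.
  by move: GJ; rewrite subEproper => /orP[/eqP e|//]; rewrite e in rG; slia.
by have := hg _ _ fG fJ pG; slia.
Qed.

End FaceSystem.

Local Open Scope ring_scope.

(** * Vector configurations *)

Section Numeric.
Variables (R : realFieldType) (T : finType).
Implicit Types (p q : T -> R).

(** Ratio test: [t] is the least [p i / - q i] over the indices with [q i < 0]. It is positive
    because [q] vanishes wherever [p] does. *)
Lemma first_zero (E : {set T}) p q : {in E, forall i, 0 <= p i} ->
  {in E, forall i, p i = 0 -> q i = 0} -> (exists2 i, i \in E & q i < 0) ->
  exists2 t, 0 < t & {in E, forall i, 0 <= p i + t * q i} /\
    exists2 j, j \in E & p j != 0 /\ p j + t * q j = 0.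
Proof.
move=> p0 pq [i0 i0E qi0].
pose P := [pred i | (i \in E) && (q i < 0)].
have P0 : P i0 by rewrite /= i0E.
case: (arg_minP (fun i => p i / - q i) P0) => j /andP[jE qj] hmin.
have pj0 : p j != 0.
  by apply/eqP => /(pq _ jE) e; rewrite e ltxx in qj.
have t0 : 0 < p j / - q j by rewrite divr_gt0 ?oppr_gt0 // lt0r pj0 p0.
exists (p j / - q j) => //; split; last first.
  by exists j => //; split=> //; rewrite invrN mulrN mulNr divfK ?subrr // lt_eqF.
move=> i iE; have [qi|qi] := ltP (q i) 0; last first.
  by rewrite addr_ge0 ?p0 // mulr_ge0 // ltW.
have := hmin i; rewrite /= iE qi => /(_ isT).
rewrite ler_pdivlMr ?oppr_gt0 // mulrN; lra.
Qed.

Lemma eventually_gt0 p q :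
  exists2 N, 0 <= N & forall i, 0 < q i -> 0 < p i + N * q i.
Proof.
exists (1 + \sum_i `|p i| / `|q i|) => [|i qi].
  by rewrite addr_ge0 // sumr_ge0 // => i _; rewrite divr_ge0.
have le : `|p i| / `|q i| <= \sum_i `|p i| / `|q i|.
  by rewrite (bigD1 i) //= lerDl sumr_ge0 // => j _; rewrite divr_ge0.
have : `|p i| <= (\sum_i `|p i| / `|q i|) * q i.
  by rewrite -ler_pdivrMr // -{1}(gtr0_norm qi).
rewrite mulrDl mul1r; have := ler_norm (- p i); rewrite normrN; lra.
Qed.

Lemma small_perturbation p q :
  exists2 e, 0 < e & forall i, 0 < p i -> 0 < p i + e * q i.
Proof.
have [N N0 hN] := eventually_gt0 q p.
have e0 : 0 < 1 + N by rewrite ltr_wpDr.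
exists (1 + N)^-1 => [|i pi]; first by rewrite invr_gt0.
have h := hN i pi; rewrite -(pmulr_rgt0 _ e0) mulrDr mulVKf ?gt_eqF //.
by rewrite mulrDl mul1r; lra.
Qed.

End Numeric.

Lemma not_submx_separation (F : fieldType) m n (M : 'M[F]_(m, n)) (u : 'rV_n) :
  ~~ (u <= M)%MS -> exists2 z : 'cV_n, M *m z = 0 & (u *m z) 0 0 != 0.
Proof.
rewrite submxE => /matrix0Pn[i [j]]; rewrite (ord1 i) => h.
exists (col j (cokermx M)).
  by rewrite colE mulmxA mulmx_coker mul0mx.
by rewrite colE mulmxA -colE mxE.
Qed.

Section Configuration.
Variables (R : realFieldType) (n : nat) (T : finType) (v : T -> 'rV[R]_n).
Implicit Types (y z : 'cV[R]_n) (I J E F : {set T}) (i j : T).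

Definition vdot y i : R := (v i *m y) 0 0.

Definition span I : 'M[R]_n := (\sum_(i in I) <<v i>>)%MS.

Definition vrk I : nat := \rank (span I).

Definition zset E y := [set i in E | vdot y i == 0].

(** For homogenised points these are the index sets of the faces of the hull, including the empty
    face and the whole. *)
Definition vface : pred {set T} :=
  fun I => `[< exists2 y, forall i, 0 <= vdot y i & I = zset setT y >].

Lemma dotD y z i : vdot (y + z) i = vdot y i + vdot z i.
Proof. by rewrite /vdot mulmxDr mxE. Qed.

Lemma dotN y i : vdot (- y) i = - vdot y i.
Proof. by rewrite /vdot mulmxN mxE. Qed.

Lemma dotZ t y i : vdot (t *: y) i = t * vdot y i.
Proof. by rewrite /vdot -scalemxAr mxE. Qed.

Definition dotE := (dotD, dotN, dotZ).

Lemma in_zset E y i : (i \in zset E y) = (i \in E) && (vdot y i == 0).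
Proof. by rewrite inE. Qed.

Lemma zset_sub E y : zset E y \subset E.
Proof. by apply/subsetP => i; rewrite in_zset => /andP[]. Qed.

Lemma sub_span I i : i \in I -> (v i <= span I)%MS.
Proof. by move=> iI; apply: (sumsmx_sup i) => //; rewrite genmxE. Qed.

Lemma span_min m I (M : 'M_(m, n)) :
  {in I, forall i, (v i <= M)%MS} -> (span I <= M)%MS.
Proof. by move=> h; apply/sumsmx_subP => i iI; rewrite genmxE h. Qed.

Lemma span_sub I J : I \subset J -> (span I <= span J)%MS.
Proof. by move=> s; apply: span_min => i /(subsetP s) /sub_span. Qed.

Lemma rkS I J : I \subset J -> (vrk I <= vrk J)%N.
Proof. by move=> s; apply/mxrankS/span_sub. Qed.

Lemma span_mul0 I y : {in I, forall i, vdot y i = 0} -> span I *m y = 0.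
Proof.
move=> h; apply/eqP; rewrite -sub_kermx; apply: span_min => i iI; rewrite sub_kermx.
by apply/eqP/matrixP => a b; rewrite !ord1 [RHS]mxE; apply: h.
Qed.

Lemma dot_submx0 m (M : 'M_(m, n)) y i : M *m y = 0 -> (v i <= M)%MS -> vdot y i = 0.
Proof. by move=> My /submxP[D e]; rewrite /vdot e -mulmxA My mulmx0 mxE. Qed.

Lemma dot_span0 I y i : {in I, forall j, vdot y j = 0} -> (v i <= span I)%MS -> vdot y i = 0.
Proof. by move/span_mul0; apply: dot_submx0. Qed.

Lemma exists_not_submx m (M : 'M_(m, n)) J : (\rank M < vrk J)%N ->
  exists2 j, j \in J & ~~ (v j <= M)%MS.
Proof.
move=> lt; apply/exists_inP; rewrite -negb_forall_in; apply/negP => /forall_inP h.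
by move: lt; rewrite ltnNge mxrankS // span_min.
Qed.

Lemma cfaceP I : reflect (exists2 y, forall i, 0 <= vdot y i & I = zset setT y) (vface I).
Proof. exact: asboolP. Qed.

Lemma cface_setT : vface setT.
Proof.
apply/cfaceP; exists 0 => [i|]; first by rewrite /vdot mulmx0 mxE.
by apply/setP => i; rewrite in_zset /vdot mulmx0 mxE eqxx inE.
Qed.

(** Adding a large multiple of the functional that defines [J] makes [y] positive outside [J] and
    does not change it on [J]. So a face of a face is a face. *)
Lemma cface_zset J y : vface J -> {in J, forall i, 0 <= vdot y i} -> vface (zset J y).
Proof.
move=> /cfaceP[yJ yJ0 eJ] h; have [N N0 hN] := eventually_gt0 (vdot y) (vdot yJ).
have inJ i : (i \in J) = (vdot yJ i == 0) by rewrite eJ in_zset inE.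
have out i : i \notin J -> 0 < vdot y i + N * vdot yJ i.
  by rewrite inJ => ne; apply: hN; rewrite lt0r ne yJ0.
apply/cfaceP; exists (y + N *: yJ) => [i|].
  rewrite !dotE; have [iJ|/out/ltW//] := boolP (i \in J).
  by move: (iJ); rewrite inJ => /eqP ->; rewrite mulr0 addr0 h.
apply/setP => i; rewrite !in_zset !dotE inE /=; have [iJ|/out] := boolP (i \in J).
  by move: (iJ); rewrite inJ => /eqP ->; rewrite mulr0 addr0.
by move/lt0r_neq0/negPf.
Qed.

(* Moving from [y] in both directions along a line on which the total
   [\sum_(l in E) vdot y l] is constant, one has to leave the polyhedron. *)
Lemma split_point E y : {in E, forall i, 0 <= vdot y i} -> (vrk (zset E y) + 2 <= vrk E)%N ->
  exists y1 y2 c1 c2, [/\ {in E, forall i, 0 <= vdot y1 i}, {in E, forall i, 0 <= vdot y2 i},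
    zset E y \proper zset E y1, zset E y \proper zset E y2 &
    [/\ 0 < c1, 0 < c2 & y = c1 *: y1 + c2 *: y2]].
Proof.
move=> y0 hr; pose x0 := \sum_(l in E) v l.
(* Adding [x0] to the span of the zero set raises the rank by at most one, so corank two leaves some
   [v j] outside. The resulting [z] vanishes on the zero set and has total zero, so [z] and [- z]
   are both negative somewhere on [E]. *)
have [|j jE hj] := @exists_not_submx _ (span (zset E y) + x0)%MS E.
  apply: (leq_ltn_trans (mxrank_adds_leqif _ _)).
  by have := rank_leq_row x0; rewrite -/(vrk _); lia.
have [z] := not_submx_separation hj; rewrite -/(vdot z j) => hz zj.
have z0 i : i \in zset E y -> vdot z i = 0.
  move=> iz; apply: dot_submx0 hz _.
  by apply: submx_trans (addsmxSl _ _); apply: sub_span.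
have sz : \sum_(l in E) vdot z l = 0.
  have -> : \sum_(l in E) vdot z l = (x0 *m z) 0 0 by rewrite mulmx_suml summxE.
  suff -> : x0 *m z = 0 by rewrite mxE.
  apply/eqP; rewrite -sub_kermx.
  by apply: submx_trans (addsmxSr (span (zset E y)) x0) _; rewrite sub_kermx hz.
have neg w : \sum_(l in E) vdot w l = 0 -> vdot w j != 0 -> exists2 i, i \in E & vdot w i < 0.
  move=> sw wj; apply/exists_inP; rewrite -[X in is_true X]negbK negb_exists_in.
  apply/negP => /forall_inP h; move: wj.
  have h' l : l \in E -> 0 <= vdot w l by move=> /h; rewrite -leNgt.
  by rewrite (psumr_eq0P h' sw jE) eqxx.
have y_eq0 i : i \in E -> vdot y i = 0 -> vdot z i = 0.
  by move=> iE yi; apply: z0; rewrite in_zset iE yi eqxx.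
have [t1 t1_gt0 [n1 [j1 j1E [yj1 e1]]]] := first_zero y0 y_eq0 (neg z sz zj).
have [|||t2 t2_gt0 [n2 [j2 j2E [yj2 e2]]]] := @first_zero _ _ E (vdot y) (vdot (- z)).
- exact: y0.
- by move=> i iE /(y_eq0 _ iE); rewrite dotN => ->; rewrite oppr0.
- apply: neg; last by rewrite dotN oppr_eq0.
  by under eq_bigr do rewrite dotN; rewrite sumrN sz oppr0.
have pr w t k : vdot w =1 (fun i => vdot y i + t * vdot k i) ->
    {in E, forall i, vdot y i = 0 -> vdot k i = 0} ->
    (exists2 l, l \in E & vdot y l != 0 /\ vdot y l + t * vdot k l = 0) ->
    zset E y \proper zset E w.
  move=> ew hk [l lE [yl el]]; apply/properP; split.
    apply/subsetP => i; rewrite !in_zset => /andP[iE /eqP yi].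
    by rewrite iE ew yi hk // mulr0 addr0 /=.
  by exists l; rewrite in_zset lE /= ?ew ?el.
exists (y + t1 *: z), (y + t2 *: - z), (t2 / (t1 + t2)), (t1 / (t1 + t2)).
have t_gt0 : 0 < t1 + t2 by rewrite addr_gt0.
split.
- by move=> i iE; rewrite !dotE; apply: n1.
- by move=> i iE; rewrite dotD dotZ; apply: n2.
- apply: (pr _ t1 z) => [i||]; [by rewrite !dotE | exact: y_eq0 | by exists j1].
- apply: (pr _ t2 (- z)) => [i||]; [by rewrite dotD dotZ | | by exists j2].
  by move=> i iE /(y_eq0 _ iE); rewrite dotN => ->; rewrite oppr0.
split; rewrite ?divr_gt0 //.
apply/matrixP => a b; rewrite !mxE; field; exact: lt0r_neq0.
Qed.

Lemma zset_combination E y1 y2 c1 c2 : {in E, forall i, 0 <= vdot y1 i} ->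
  {in E, forall i, 0 <= vdot y2 i} -> 0 < c1 -> 0 < c2 ->
  zset E (c1 *: y1 + c2 *: y2) = zset E y1 :&: zset E y2.
Proof.
move=> h1 h2 c1_gt0 c2_gt0; apply/setP => i; rewrite in_setI !in_zset.
case: (boolP (i \in E)) => //= iE; rewrite !dotE paddr_eq0 ?mulr_ge0 ?h1 ?h2 ?ltW //.
by rewrite !mulf_eq0 (gt_eqF c1_gt0) (gt_eqF c2_gt0).
Qed.

(** The rank is strictly monotone because the functional cutting out [I] vanishes on the span of
    [I]. For the splitting, a positive combination of nonnegative functionals vanishes exactly where
    both do. *)
Lemma face_system_cface : face_system vface vrk.
Proof.
split.
- move=> I J /cfaceP[y y0 eI] fJ; move: (fJ) => /cfaceP[z z0 eJ].
  have -> : I :&: J = zset J y by apply/setP => i; rewrite eI !inE andbC.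
  by apply: cface_zset.
- move=> I J /cfaceP[y y0 eI] fJ /properP[s [j jJ jI]].
  apply: rank_ltmx; rewrite ltmxE span_sub //=; apply: contra jI => s'.
  rewrite eI in_zset inE /=; apply/eqP.
  apply: (@dot_span0 I); last by apply: submx_trans s'; apply: sub_span.
  by move=> i; rewrite eI in_zset => /andP[_ /eqP].
- move=> I J /cfaceP[y y0 eI] fJ IJ hr.
  have eI' : zset J y = I.
    apply/setP => i; rewrite eI !inE /=; apply/andb_idl => yi.
    by apply: (subsetP (proper_sub IJ)); rewrite eI !inE.
  rewrite -eI' in hr IJ *.
  have [|y1 [y2 [c1 [c2 [h1 h2 p1 p2 [c1_gt0 c2_gt0 ey]]]]]] := split_point _ hr.
    by move=> i _; apply: y0.
  have e : zset J y1 :&: zset J y2 = zset J y by rewrite ey zset_combination.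
  have q (A B : {set T}) : A :&: B = zset J y -> A \subset J -> B \subset J ->
      zset J y \proper B -> A \proper J.
    move=> eAB AJ BJ pB; rewrite properEneq AJ andbT; apply/eqP => eA.
    by move: pB; rewrite -eAB eA (setIidPr BJ) properE subxx.
  exists (zset J y1), (zset J y2); split=> //; first by split; apply: cface_zset.
  by split; [apply: q e _ _ p2 | rewrite setIC in e; apply: q e _ _ p1]; apply: zset_sub.
Qed.

End Configuration.

(** * The bound by the number of vertices *)

(** Monotonicity reduces to [d = a + b]. Moving one unit from the larger argument to the smaller
    then does not increase the sum, by Pascal's rule. *)
Lemma leq_bin_balanced a b d k : (d <= a + b)%N ->
  ('C(uphalf d, k) + 'C(d./2, k) <= 'C(a, k) + 'C(b, k))%N.
Proof.
wlog ab : a b / (a <= b)%N => [th|].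
  by case: (leqP a b) => [|/ltnW] ab h; [|rewrite addnC [leqRHS]addnC addnC];
     apply: th; rewrite // addnC.
move=> h; have := leq_bin2l.
move=> mono; apply: (@leq_trans ('C(uphalf (a + b), k) + 'C((a + b)./2, k))).
  by apply: leq_add; apply: mono; slia.
clear h d; move: {2}(b - a)%N (leqnn (b - a)) => r.
elim: r a b ab => [|r IH] a b ab hr.
  have -> : a = b by slia.
  have e1 : uphalf (b + b) = b by slia.
  have e2 : (b + b)./2 = b by slia.
  by rewrite e1 e2.
have [le|lt] := leqP b a.+1.
  have [->|->] : b = a \/ b = a.+1 by slia.
    have e1 : uphalf (a + a) = a by slia.
    have e2 : (a + a)./2 = a by slia.
    by rewrite e1 e2.
  have e1 : uphalf (a + a.+1) = a.+1 by slia.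
  have e2 : (a + a.+1)./2 = a by slia.
  by rewrite e1 e2 addnC.
case: b ab hr lt => [|b] ab hr lt; first by slia.
have -> : (a + b.+1 = a.+1 + b)%N by slia.
apply: (leq_trans (IH a.+1 b _ _)); [slia | slia |].
case: k {IH} => [|k]; rewrite ?bin0 // !binS.
have : ('C(a, k) <= 'C(b, k))%N by apply: mono; slia.
slia.
Qed.

(** Some [k]-subset of a disjoint union of sets of sizes [a] and [b] meets both parts; the induction
    expresses this through Pascal's rule. It excludes equality for [1 < k]. *)
Lemma ltn_bin_add a b k : (0 < a)%N -> (0 < b)%N -> (1 < k <= a + b)%N ->
  ('C(a, k) + 'C(b, k) < 'C(a + b, k))%N.
Proof.
elim: a => // a IH _ b0 /andP[k1 kab]; have [ek|/eqP lt] := eqVneq k (a.+1 + b)%N.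
  by rewrite -ek binn !bin_small //; slia.
case: k k1 kab lt IH => // k k1 kab lt IH; rewrite addSn !binS.
have le : ('C(a, k) <= 'C(a + b, k))%N by apply: leq_bin2l; slia.
case: a IH kab lt le => [_|a IH] kab lt le.
  case: k k1 kab lt le => // k k1 kab lt le; rewrite !bin0n /= !add0n.
  by rewrite -[ltnLHS]addn0 ltn_add2l bin_gt0; slia.
by have := IH isT b0 (ltac:(slia)); rewrite !addSn in le *; slia.
Qed.

Lemma sum_card_rel (S1 S2 : finType) (A : {set S1}) (B : {set S2}) (r : S1 -> S2 -> bool) :
  (\sum_(x in A) #|[set y in B | r x y]| = \sum_(y in B) #|[set x in A | r x y]|)%N.
Proof.
transitivity (\sum_(x in A) \sum_(y in B) r x y)%N.
  by apply: eq_bigr => x _; rewrite -sum1_card -big_mkcondr; apply: eq_bigl => y; rewrite inE.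
rewrite exchange_big; apply: eq_bigr => y _.
by rewrite -sum1_card -big_mkcondr; apply: eq_bigl => x; rewrite inE.
Qed.

Section FirstBound.
Variables (R : realFieldType) (n : nat) (T : finType) (v : T -> 'rV[R]_n).
(** The height coordinate of the homogenisation. All vectors lie on the hyperplane where it is 1, so
    the empty set is a face and proportional vectors are equal. *)
Variable y0 : 'cV[R]_n.
Hypothesis y0_1 : forall i, vdot v y0 i = 1.
Implicit Types (y z h : 'cV[R]_n) (I J F L X : {set T}) (i j l : T).

Local Notation dot := (vdot v).
Local Notation rk := (vrk v).
Local Notation cface := (vface v).
Local Notation itv := (interval cface rk).
Local Notation fs := (face_system_cface v).

(** The linear rank of a face exceeds its affine dimension by one. *)
Definition cfaces k := [set L | cface L && (rk L == k.+1)].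

Lemma cface_set0 : cface set0.
Proof.
apply/cfaceP; exists y0 => [i|]; first by rewrite y0_1.
by apply/setP => i; rewrite !inE y0_1 oner_eq0.
Qed.

Lemma rk_set0 : rk set0 = 0%N.
Proof. by rewrite /rk /span big_set0 mxrank0. Qed.

Lemma v_neq0 i : v i != 0.
Proof.
apply/eqP => e; have := y0_1 i; rewrite /vdot e mul0mx mxE => /esym/eqP.
by rewrite oner_eq0.
Qed.

(** Points may repeat, so a vertex is a set of indices. They all carry one vector, since
    proportional vectors at height 1 coincide. *)
Lemma vertex_eq X i j : rk X = 1%N -> i \in X -> j \in X -> v i = v j.
Proof.
move=> rX iX jX.
have s : (v i <= span v X)%MS by apply: sub_span.
have : (v j <= v i)%MS.
  apply: submx_trans (sub_span v jX) _.
  by rewrite -(geq_leqif (mxrank_leqif_sup s)) rank_rV v_neq0 -/(rk X) rX.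
move/sub_rVP => [a e]; rewrite e; have := y0_1 j.
by rewrite /vdot e -scalemxAl mxE -/(dot y0 i) y0_1 mulr1 => ->; rewrite scale1r.
Qed.

Lemma eq_cface X i j : cface X -> v i = v j -> i \in X -> j \in X.
Proof. by move=> /cfaceP[y _ ->] e; rewrite !in_zset !inE /vdot e. Qed.

Lemma rk_gt0 X : (0 < rk X)%N -> exists i, i \in X.
Proof. by move=> h; apply/set0Pn; apply: contraTneq h => ->; rewrite rk_set0. Qed.

Definition generic h := forall i j, dot h i = dot h j -> v i = v j.

(** A small multiple of a functional that separates two tied vectors breaks their tie and preserves
    all strict inequalities, so the number of ties decreases. *)
Lemma generic_perturbation y :
  exists2 h, generic h & forall i j, dot y i < dot y j -> dot h i < dot h j.
Proof.
suff H r h : (#|[set ij : T * T | (v ij.1 != v ij.2) && (dot h ij.1 == dot h ij.2)]| <= r)%N ->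
    (forall i j, dot y i < dot y j -> dot h i < dot h j) ->
  exists2 h, generic h & forall i j, dot y i < dot y j -> dot h i < dot h j.
  exact: (H _ y (leqnn _)).
elim: r h => [|r IH] h hr yh.
  exists h => // i j e; apply/eqP; apply: contraTT hr => ne; rewrite -ltnNge card_gt0.
  by apply/set0Pn; exists (i, j); rewrite inE /= ne e eqxx.
have [[[i j] /= /andP[ne /eqP e]]|none] :=
  pselect (exists ij : T * T, (v ij.1 != v ij.2) && (dot h ij.1 == dot h ij.2)); last first.
  exists h => // i j e; apply/eqP/negPn/negP => ne; apply: none.
  by exists (i, j); rewrite ne e eqxx.
have [z _ zij] : exists2 z : 'cV_n, (0 : 'M[R]_n) *m z = 0 & ((v i - v j) *m z) 0 0 != 0.
  by apply: (@not_submx_separation _ n n 0); rewrite submx0 subr_eq0.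
have zne : dot z i != dot z j by move: zij; rewrite mulmxBl /vdot !mxE subr_eq0.
have [e' e0 he] := small_perturbation (fun ij : T * T => dot h ij.2 - dot h ij.1)
  (fun ij => dot z ij.2 - dot z ij.1).
have lt k l : dot h k < dot h l -> dot (h + e' *: z) k < dot (h + e' *: z) l.
  by rewrite !dotE => lt; have := he (k, l); rewrite /= subr_gt0 => /(_ lt); lra.
apply: (IH (h + e' *: z)) => [|k l /yh]; last exact: lt.
rewrite -ltnS; apply: leq_trans hr; apply/proper_card/properP; split.
  apply/subsetP => [[k l]]; rewrite !inE /= => /andP[-> /=].
  apply: contraTT => ne'; have [/lt/lt_eqF->//|/lt/lt_eqF|e2] := ltgtP (dot h k) (dot h l).
    by rewrite eq_sym => ->.
  by rewrite e2 eqxx in ne'.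
exists (i, j); first by rewrite inE /= ne e eqxx.
rewrite inE /= ne /= !dotE e.
by apply: contra zne => /eqP/addrI/mulfI->//; rewrite gt_eqF.
Qed.

Lemma generic_opp h : generic h -> generic (- h).
Proof. by move=> g i j; rewrite !dotE => /oppr_inj/g. Qed.

(* [F] and [F'] are the zero sets of [y] and [y + w] for a vertex [y] of the
   polyhedron [{y | y >= 0, y + w >= 0, y = 0 at i0}], where [w] is [h] shifted
   to vanish at [i0]. *)
Lemma opposite_faces h X i0 : cface X -> rk X = 1%N -> i0 \in X ->
  exists F F', [/\ cface F, cface F', i0 \in F, i0 \in F' &
    [/\ {in F, forall l, dot h i0 <= dot h l}, {in F', forall l, dot h l <= dot h i0} &
        (rk setT < rk F + rk F')%N]].
Proof.
move=> fX rX iX; pose w := h - dot h i0 *: y0.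
have dw i : dot w i = dot h i - dot h i0 by rewrite /w !dotE y0_1 mulr1.
clearbody w.
pose Z y := zset v setT y :|: zset v setT (y + w).
pose S y := [/\ forall i, 0 <= dot y i, forall i, 0 <= dot (y + w) i & dot y i0 = 0].
suff [y [y1 y2 yi] hy] : exists2 y, S y & (rk setT <= rk (Z y))%N.
  exists (zset v setT y), (zset v setT (y + w)).
  have fF : cface (zset v setT y) by apply: cface_zset; [apply: cface_setT|].
  have fF' : cface (zset v setT (y + w)) by apply: cface_zset; [apply: cface_setT|].
  have iF : i0 \in zset v setT y by rewrite in_zset inE yi eqxx.
  have iF' : i0 \in zset v setT (y + w) by rewrite in_zset inE dotD dw yi subrr addr0 eqxx.
  split=> //; split.
  - move=> l; rewrite in_zset inE /= => /eqP yl; have := y2 l; rewrite dotD dw yl; lra.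
  - move=> l; rewrite in_zset inE dotD dw /= => /eqP yl; have := y1 l; lra.
  (* The two spans share [v i0], so the dimension formula makes the rank inequality strict. *)
  apply: (leq_ltn_trans hy); rewrite -[(rk _ + rk _)%N]mxrank_sum_cap.
  have c : (v i0 <= span v (zset v setT y) :&: span v (zset v setT (y + w)))%MS.
    by rewrite sub_capmx !sub_span.
  have : (0 < \rank (span v (zset v setT y) :&: span v (zset v setT (y + w))))%N.
    by apply: leq_trans (mxrankS c); rewrite rank_rV v_neq0.
  have : (rk (Z y) <= \rank (span v (zset v setT y) + span v (zset v setT (y + w)))%MS)%N.
    apply/mxrankS/span_min => i; rewrite in_setU => /orP[] iZ.
      by apply: submx_trans (addsmxSl _ _); apply: sub_span.
    by apply: submx_trans (addsmxSr _ _); apply: sub_span.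
  slia.
(* A large multiple of the functional defining [X] is a starting point: it dominates [w] off [X],
   and [w] vanishes on [X]. *)
have [y Sy] : exists y, S y.
  move: (fX) => /cfaceP[yX yX0 eX].
  have [N N0 hN] := eventually_gt0 (dot w) (dot yX).
  have yXi : dot yX i0 = 0 by move: iX; rewrite eX in_zset => /andP[_ /eqP].
  exists (N *: yX); split=> [i|i|]; rewrite ?dotE ?yXi ?mulr0 ?mulr_ge0 ?yX0 //.
  have [yi|] := eqVneq (dot yX i) 0; last first.
    by move=> ne; rewrite addrC; apply/ltW/hN; rewrite lt0r ne yX0.
  have iX' : i \in X by rewrite eX in_zset inE yi eqxx.
  by rewrite dw yi mulr0 /vdot (vertex_eq rX iX' iX) subrr addr0.
(* Induct on the missing rank: moving along a functional that vanishes on [Z y] until a new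
   constraint becomes tight raises the rank. *)
move: {2}(rk setT - rk (Z y))%N (leqnn (rk setT - rk (Z y))) => r.
elim: r y Sy => [|r IH] y Sy hr; first by exists y => //; slia.
have [le|lt] := leqP (rk setT) (rk (Z y)); first by exists y.
have [y1 y2 yi] := Sy.
have [j _ hj] := exists_not_submx lt.
have [z hz zj] : exists2 z : 'cV_n, span v (Z y) *m z = 0 & dot z j < 0.
  have [z hz zj] := not_submx_separation hj.
  have [lt0|ge0] := ltP (dot z j) 0; first by exists z.
  by exists (- z); rewrite ?mulmxN ?hz ?oppr0 // dotN oppr_lt0 lt_neqAle eq_sym zj.
have zZ i : i \in Z y -> dot z i = 0.
  by move=> iZ; apply: dot_submx0 hz _; apply: sub_span.
(* Indexing by [T + T] lets a single ratio test treat both families of constraints. *)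
pose p (s : T + T) := match s with inl i => dot y i | inr i => dot (y + w) i end.
pose q (s : T + T) := match s with inl i => dot z i | inr i => dot z i end.
have [|||t t0 [ht [l _ [pl el]]]] := @first_zero _ _ [set: T + T] p q.
- by case=> i _ /=.
- by case=> i _ /= e; apply: zZ; rewrite in_setU !in_zset !inE e eqxx ?orbT.
- by exists (inl j).
have iZ0 : i0 \in Z y by rewrite in_setU in_zset inE yi eqxx.
have Sy' : S (y + t *: z).
  split=> [i|i|]; last by rewrite !dotE yi (zZ _ iZ0) mulr0 addr0.
    by rewrite !dotE; apply: (ht (inl i)); rewrite inE.
  by have := ht (inr i); rewrite inE /= !dotE => /(_ isT); lra.
apply: (IH _ Sy').
have sub : Z y \subset Z (y + t *: z).
  apply/subsetP => i iZ; move: (iZ); rewrite !in_setU !in_zset !inE !dotE (zZ _ iZ).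
  by rewrite mulr0 addr0.
have [i iZ' iz] : exists2 i, i \in Z (y + t *: z) & dot z i != 0.
  case: l pl el => i /= pl el; exists i.
  - by rewrite in_setU in_zset inE !dotE el eqxx.
  - by apply: contraNneq pl => e; rewrite e mulr0 addr0 in el; rewrite el.
  - by rewrite in_setU !in_zset !inE addrAC [dot (y + w + _) i]dotD dotZ el eqxx orbT.
  - by apply: contraNneq pl => e; rewrite e mulr0 addr0 in el; rewrite el.
suff : (rk (Z y) < rk (Z (y + t *: z)%R))%N by slia.
apply: rank_ltmx; rewrite ltmxE span_sub //=; apply: contra iz => s.
by apply/eqP; apply: dot_submx0 hz _; apply: submx_trans s; apply: sub_span.
Qed.

Definition topped h X k :=
  [set L in cfaces k | X \subset L & [forall i in X, [forall l in L, dot h l <= dot h i]]].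

Lemma leq_bin_topped h X F k : cface X -> rk X = 1%N -> cface F -> X \subset F ->
  {in X & F, forall i l, dot h l <= dot h i} -> ('C((rk F).-1, k) <= #|topped h X k|)%N.
Proof.
move=> fX rX fF XF hF; have := interval_bin_le fs k fX fF XF.
rewrite rX subn1 add1n => /leq_trans; apply; apply/subset_leq_card/subsetP => L.
rewrite !inE => /and4P[-> -> LF ->] /=; apply/forall_inP => i iX.
by apply/forall_inP => l /(subsetP LF); apply: hF.
Qed.

Lemma topped_opp_bound h X k d : rk setT = d.+1 -> X \in cfaces 0 ->
  ('C(uphalf d, k) + 'C(d./2, k) <= #|topped h X k| + #|topped (- h) X k|)%N.
Proof.
move=> rT; rewrite inE => /andP[fX /eqP rX].
have [i0 iX] : exists i, i \in X by apply: rk_gt0; rewrite rX.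
have [F [F' [fF fF' iF iF' [hF hF' hr]]]] := opposite_faces h fX rX iX.
have sub G : cface G -> i0 \in G -> X \subset G.
  by move=> fG iG; apply/subsetP => i iX'; apply: eq_cface iG => //; apply: vertex_eq iX iX'.
have e i : i \in X -> v i = v i0 by move=> iX'; apply: vertex_eq iX' iX.
(* [X] is highest on [F'] and lowest on [F]. Their dimensions, one less than the ranks, add up to at
   least [d], and the balanced split is the worst case. *)
rewrite addnC; apply: leq_trans (leq_add (leq_bin_topped k fX rX fF' (sub _ fF' iF') _)
  (leq_bin_topped k fX rX fF (sub _ fF iF) _)).
- by rewrite addnC; apply: leq_bin_balanced; slia.
- by move=> i l iX' lF; rewrite {2}/vdot e // hF'.
- by move=> i l iX' lF; rewrite !dotN lerN2 {1}/vdot e // hF.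
Qed.

(** A generic functional has at most one top vertex on each face, so double counting meets each
    [k]-face at most once. *)
Lemma sum_topped h k : generic h -> (\sum_(X in cfaces 0) #|topped h X k| <= #|cfaces k|)%N.
Proof.
move=> g; rewrite (sum_card_rel (cfaces 0) (cfaces k)
  (fun X L => (X \subset L) && [forall i in X, [forall l in L, dot h l <= dot h i]])).
rewrite -sum1_card; apply: leq_sum => L _.
apply/card_le1_eqP => X X'; rewrite !inE.
move=> /andP[/andP[fX /eqP rX] /andP[XL /forall_inP tX]].
move=> /andP[/andP[fX' /eqP rX'] /andP[XL' /forall_inP tX']].
have [i iX] : exists i, i \in X by apply: rk_gt0; rewrite rX.
have [j jX] : exists i, i \in X' by apply: rk_gt0; rewrite rX'.
have e : v i = v j.
  apply: g; apply/eqP; rewrite eq_le.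
  have /forall_inP/(_ _ (subsetP XL' _ jX)) -> := tX _ iX.
  by have /forall_inP/(_ _ (subsetP XL _ iX)) -> := tX' _ jX.
apply/esym/setP => l; apply/idP/idP => lX.
  by apply: (eq_cface fX' _ jX); rewrite -e; apply: (vertex_eq rX iX lX).
by apply: (eq_cface fX _ iX); rewrite e; apply: (vertex_eq rX' jX lX).
Qed.

(* A functional that has its strict maximum at [X] makes [X] the top vertex of
   every face through it. *)
Lemma first_bound_at X k d : rk setT = d.+1 -> X \in cfaces 0 ->
  (#|cfaces 0| * ('C(uphalf d, k) + 'C(d./2, k)) + #|itv X setT k.+1|
     <= 2 * #|cfaces k| + ('C(uphalf d, k) + 'C(d./2, k)))%N.
Proof.
move=> rT X0; move: (X0); rewrite inE => /andP[fX /eqP rX].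
move: (fX) => /cfaceP[yX yX0 eX].
have [h g hX] := generic_perturbation (- yX).
have top : itv X setT k.+1 \subset topped h X k.
  apply/subsetP => L; rewrite !inE => /and4P[-> -> _ ->] /=.
  apply/forall_inP => i iX; apply/forall_inP => l _.
  have [lX|lX] := boolP (l \in X); first by rewrite /vdot (vertex_eq rX iX lX).
  apply/ltW/hX; rewrite !dotN ltrN2.
  move: iX lX; rewrite eX !in_zset !inE /= => /eqP-> ne.
  by rewrite lt0r ne yX0.
set B := ('C(_, _) + _)%N.
have : (\sum_(Y in cfaces 0) (#|topped h Y k| + #|topped (- h) Y k|) <= 2 * #|cfaces k|)%N.
  by rewrite big_split /= mul2n -addnn leq_add ?sum_topped //; apply: generic_opp.
(* The term of [X] is bounded below by the number of all [k]-faces through [X], every other term by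
   [B]. *)
rewrite (bigD1 X) //= (cardsD1 X (cfaces 0)) X0 mulnDl mul1n => hs.
have : (#|cfaces 0 :\ X| * B <=
    \sum_(i in cfaces 0 | i != X) (#|topped h i k| + #|topped (- h) i k|))%N.
  rewrite -sum_nat_const.
  rewrite [X in (_ <= X)%N](eq_bigl (mem (cfaces 0 :\ X))); last by move=> Y; rewrite !inE andbC.
  by apply: leq_sum => Y; rewrite in_setD1 => /andP[_ Y0]; apply: topped_opp_bound.
move=> hB; rewrite -addnA [leqLHS]addnC leq_add2r [leqLHS]addnC.
apply: leq_trans hs; apply: leq_add hB.
exact: leq_trans (subset_leq_card top) (leq_addr _ _).
Qed.

Lemma card_cfaces_gt0 k : (k < rk setT)%N -> (0 < #|cfaces k|)%N.
Proof.
move=> h; have := interval_bin_le fs k.+1 cface_set0 (cface_setT v) (sub0set _).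
rewrite rk_set0 subn0 add0n => le; have : (0 < 'C(rk setT, k.+1))%N by rewrite bin_gt0.
move=> /leq_trans /(_ le) /leq_trans; apply.
by apply/subset_leq_card/subsetP => L; rewrite !inE => /and4P[-> _ _ ->].
Qed.

(** For positive [k], a vertex lies on at least ['C(d, k)] of the [k]-faces, so [first_bound_at]
    gives the inequality. Under equality it bounds that number from above, at every vertex, by the
    balanced sum. *)
Theorem cfaces_bound d k : rk setT = d.+1 -> (k < d)%N ->
  (#|cfaces 0| * ('C(uphalf d, k) + 'C(d./2, k)) <= 2 * #|cfaces k|)%N /\
  ((#|cfaces 0| * ('C(uphalf d, k) + 'C(d./2, k)) = 2 * #|cfaces k|)%N <->
    k = 0%N \/ k = 1%N /\ forall X, X \in cfaces 0 -> #|itv X setT d| = d).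
Proof.
move=> rT kd; have d0 : (0 < d)%N by slia.
have [->|k0] := posnP k.
  by rewrite !bin0 mulnC leqnn; split=> //; split=> // _; left.
have fT := cface_setT v.
have cardX X : X \in cfaces 0 -> ('C(d, k) <= #|itv X setT k.+1|)%N.
  rewrite inE => /andP[fX /eqP rX]; have := interval_bin_le fs k fX fT (subsetT X).
  by rewrite rT rX subSS subn0 add1n.
have [X0 hX0] : exists X, X \in cfaces 0.
  by apply/set0Pn; rewrite -card_gt0 card_cfaces_gt0 // rT.
have le : ('C(uphalf d, k) + 'C(d./2, k) <= 'C(d, k))%N.
  have := @leq_bin_balanced d 0 d k; rewrite bin0n (gtn_eqF k0) /= !addn0.
  exact.
have base : (#|cfaces 0| * ('C(uphalf d, k) + 'C(d./2, k)) <= 2 * #|cfaces k|)%N.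
  rewrite -(leq_add2r ('C(uphalf d, k) + 'C(d./2, k))).
  apply: leq_trans (first_bound_at k rT hX0).
  by rewrite leq_add2l (leq_trans le) // cardX.
split; first exact: base.
have hB : (uphalf d + d./2 = d)%N by slia.
split=> [e|[k_eq0|[k_eq1 hX]]]; last 2 first.
- by rewrite k_eq0 in k0.
(* [atoms_coatoms] turns [d] facets at each vertex into [d] edges. Counting incidences, with at
   least two vertices on each edge, yields the reverse inequality. *)
- rewrite k_eq1 in base *; apply/eqP; rewrite eqn_leq base /= !bin1 hB.
  have atoms X : X \in cfaces 0 -> #|itv X setT 2| = d.
    move=> X_0; move: (X_0); rewrite inE => /andP[fX /eqP rX].
    have := atoms_coatoms fs fX fT (subsetT X) (r := d); rewrite rT rX => /(_ erefl d0) [_].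
    by apply; apply: hX.
  rewrite -sum_nat_const -(eq_bigr _ atoms).
  rewrite [leqRHS](eq_bigr (fun X => #|[set L in cfaces 1 | X \subset L]|)); last first.
    move=> X _; apply: eq_card => L; rewrite !inE subsetT /=.
    by case: (cface L); case: (X \subset L); rewrite ?andbF ?andbT.
  rewrite sum_card_rel mulnC -sum_nat_const; apply: leq_sum => L.
  rewrite inE => /andP[fL /eqP rL].
  have := interval_bin_le fs 1 cface_set0 fL (sub0set _).
  rewrite rL rk_set0 bin1 => /leq_trans; apply; apply/subset_leq_card/subsetP => X.
  by rewrite !inE => /and4P[-> _ -> ->].
have bound X : X \in cfaces 0 -> (#|itv X setT k.+1| <= 'C(uphalf d, k) + 'C(d./2, k))%N.
  by move=> X_0; have := first_bound_at k rT X_0; rewrite e leq_add2l.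
(* For [k = 1] the balanced sum is [d], so each vertex is on exactly [d] edges, hence on [d] facets.
   For [1 < k] it is less than ['C(d, k)], a contradiction. *)
have [k1|k2] : k = 1%N \/ (1 < k)%N by slia.
  right; split=> // X X_0; move: (X_0); rewrite inE => /andP[fX /eqP rX].
  have := atoms_coatoms fs fX fT (subsetT X) (r := d); rewrite rT rX => /(_ erefl d0) [h _].
  apply: h; apply/eqP; rewrite eqn_leq.
  have := bound _ X_0; have := cardX _ X_0.
  by rewrite k1 !bin1 hB => -> ->.
have lt : ('C(uphalf d, k) + 'C(d./2, k) < 'C(d, k))%N.
  by rewrite -[in ltnRHS]hB; apply: ltn_bin_add; rewrite ?hB ?k2 ?(ltnW kd) //; slia.
by have := leq_trans lt (leq_trans (cardX _ hX0) (bound _ hX0)); rewrite ltnn.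
Qed.

(** Shifting [y] by its minimum on [J] gives a functional whose zero set is a nonempty face of [J].
    That face contains a vertex, where [y] attains its minimum. *)
Lemma nonneg_of_vertices J y : cface J ->
  (forall X i, X \in itv set0 J 1 -> i \in X -> 0 <= dot y i) ->
  {in J, forall i, 0 <= dot y i}.
Proof.
move=> fJ hX i iJ; rewrite leNgt; apply/negP => yi.
case: (@arg_minP _ _ _ i (mem J) (dot y) iJ) => i0 i0J hmin.
pose z := y - dot y i0 *: y0.
have dz l : dot z l = dot y l - dot y i0 by rewrite /z !dotE y0_1 mulr1.
clearbody z.
have fF : cface (zset v J z).
  by apply: cface_zset => // l lJ; rewrite dz subr_ge0; apply: hmin.
have iF : i0 \in zset v J z by rewrite in_zset (i0J : i0 \in J) dz subrr eqxx.
have rF : (0 < rk (zset v J z))%N.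
  rewrite -rk_set0; apply: (rk_proper fs cface_set0 fF).
  by rewrite proper0; apply/set0Pn; exists i0.
have [X] : exists X, X \in itv set0 (zset v J z) 1.
  apply/set0Pn; rewrite -card_gt0.
  have := interval_bin_le fs 1 cface_set0 fF (sub0set _).
  by rewrite rk_set0 subn0 bin1; apply: leq_trans.
rewrite inE => /and4P[fX _ XF /eqP rX].
have [l lX] : exists l, l \in X by apply: rk_gt0; rewrite rX.
have XJ : X \in itv set0 J 1.
  by rewrite inE fX sub0set rX (subset_trans XF) ?zset_sub.
have := hX X l XJ lX; have := subsetP XF _ lX.
rewrite in_zset dz subr_eq0 => /andP[_ /eqP ->].
by have := hmin i iJ => le; rewrite leNgt (le_lt_trans le yi).
Qed.

End FirstBound.

(** * The dual configuration *)

Section Duality.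
Variables (R : realFieldType) (n : nat) (T : finType) (v : T -> 'rV[R]_n).
Variable y0 : 'cV[R]_n.
Hypothesis y0_1 : forall i, vdot v y0 i = 1.
Implicit Types (y z : 'cV[R]_n) (I J F L X : {set T}) (i j l : T).

Local Notation dot := (vdot v).
Local Notation rk := (vrk v).
Local Notation cface := (vface v).
Local Notation itv := (interval cface rk).
Local Notation fs := (face_system_cface v).

Definition facets := [set J | cface J && ((rk J).+1 == rk setT)].

Local Notation facet := {J : {set T} | J \in facets}.

(** Some vector lies off the facet, so the total is positive and can be scaled to 1. This puts the
    normals at height 1 for the constant functional, as the first bound requires of the dual. *)
Lemma exists_facet_normals : exists a : facet -> 'cV[R]_n, forall J : facet,
  [/\ forall i, 0 <= dot (a J) i, val J = zset v setT (a J) & \sum_i dot (a J) i = 1].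
Proof.
apply: (@fin_all_exists _ (fun=> 'cV[R]_n) (fun (J : facet) y =>
  [/\ forall i, 0 <= dot y i, val J = zset v setT y & \sum_i dot y i = 1])).
case=> J /=; rewrite inE => /andP[/cfaceP[y h0 eJ] /eqP rJ].
have [l lJ] : exists l, l \notin J.
  apply/existsP; rewrite -negb_forall; apply/negP => /forallP h.
  have eT : J = setT by apply/setP => i; rewrite h inE.
  by move: rJ; rewrite eT; slia.
have s0 : 0 < \sum_i dot y i.
  rewrite (bigD1 l) //= ltr_pwDl ?sumr_ge0 // lt0r h0 andbT.
  by move: lJ; rewrite eJ in_zset inE.
exists ((\sum_i dot y i)^-1 *: y); split=> [i||].
- by rewrite dotZ mulr_ge0 ?invr_ge0 // ltW.
- by rewrite /= {1}eJ; apply/setP => i; rewrite !in_zset dotZ mulf_eq0 invr_eq0 (gt_eqF s0).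
- by under eq_bigr do rewrite dotZ; rewrite -mulr_sumr mulVf // gt_eqF.
Qed.

Variable a : facet -> 'cV[R]_n.
Hypothesis a_ge0 : forall (J : facet) i, 0 <= dot (a J) i.
Hypothesis zset_a : forall J : facet, val J = zset v setT (a J).
Hypothesis sum_a : forall J : facet, \sum_i dot (a J) i = 1.

Lemma mem_facet (J : facet) i : (i \in val J) = (dot (a J) i == 0).
Proof. by rewrite zset_a in_zset inE. Qed.

(** This is the value of [y] at the combination of the [v i] with coefficients [x i]. *)
Definition ev (x : T -> R) y := \sum_i x i * dot y i.

Lemma evZ x c y : ev x (c *: y) = c * ev x y.
Proof.
by rewrite /ev mulr_sumr; apply: eq_bigr => i _; rewrite dotZ mulrCA.
Qed.

Lemma evD x y z : ev x (y + z) = ev x y + ev x z.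
Proof.
by rewrite /ev -big_split; apply: eq_bigr => i _; rewrite dotD mulrDr.
Qed.

(** A facet and one vector [v l] off it span everything. Choosing [c] to match the values at [l]
    makes the difference vanish on both. *)
Lemma facet_normal_unique (J : facet) y : (forall i, 0 <= dot y i) -> val J = zset v setT y ->
  exists2 c, 0 < c & forall i, dot y i = c * dot (a J) i.
Proof.
move=> h0 eJ; have := valP J; rewrite inE => /andP[_ /eqP rJ].
have [l _ lJ] : exists2 l, l \in setT & ~~ (v l <= span v (val J))%MS.
  by apply: exists_not_submx; rewrite -rJ ltnS leqnn.
have lJ' : l \notin val J by apply: contra lJ; apply: sub_span.
have al : 0 < dot (a J) l by rewrite lt0r a_ge0 andbT -mem_facet.
have yl : 0 < dot y l by rewrite lt0r h0 andbT; move: lJ'; rewrite eJ in_zset inE.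
exists (dot y l / dot (a J) l) => [|i]; first by rewrite divr_gt0.
set c := _ / _; pose z := y - c *: a J.
suff : dot z i = 0 by rewrite /z !dotE; lra.
have zJ : {in val J, forall j, dot z j = 0}.
  move=> j jJ; rewrite /z !dotE.
  have := jJ; rewrite eJ in_zset inE => /eqP ->.
  by have := jJ; rewrite mem_facet => /eqP ->; rewrite mulr0 subrr.
have zl : dot z l = 0 by rewrite /z !dotE divfK ?subrr // gt_eqF.
have zM : (span v (val J) + v l)%MS *m z = 0.
  apply/eqP; rewrite -sub_kermx addsmx_sub !sub_kermx span_mul0 ?eqxx //=.
  by apply/eqP/matrixP => s t; rewrite !ord1 [RHS]mxE.
apply: dot_submx0 zM _.
have sT : (span v (val J) + v l <= span v setT)%MS.
  by rewrite addsmx_sub span_sub ?subsetT // sub_span ?inE.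
have lt : (span v (val J) < span v (val J) + v l)%MS.
  by rewrite ltmxE addsmxSl /= addsmx_sub submx_refl.
suff /andP[_ s] : (span v (val J) + v l == span v setT)%MS.
  by apply: submx_trans s; rewrite sub_span ?inE.
by rewrite -(geq_leqif (mxrank_leqif_eq sT)) -/(rk _) -rJ; apply: rank_ltmx.
Qed.

(* Minkowski--Weyl: a functional nonnegative on the facet normals is nonnegative
   on the whole dual cone, since splitting a point of the dual cone along a line
   strictly increases its zero set. *)
Lemma facet_normals_generate x : (forall J : facet, 0 <= ev x (a J)) ->
  forall y, (forall i, 0 <= dot y i) -> 0 <= ev x y.
Proof.
move=> hx y; move: {2}(rk setT - rk (zset v setT y))%N (leqnn (rk setT - rk (zset v setT y))) => r.
have fz z : (forall i, 0 <= dot z i) -> cface (zset v setT z).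
  by move=> h; apply: cface_zset => [|i _]; [apply: cface_setT | apply: h].
elim: r y => [|r IH] y hr y_ge0.
  have e : zset v setT y = setT.
    apply: (face_eq_rk fs); [exact: fz | exact: cface_setT | exact: subsetT | slia].
  rewrite /ev big1 // => i _; have : i \in zset v setT y by rewrite e inE.
  by rewrite in_zset => /andP[_ /eqP->]; rewrite mulr0.
have [le|gt] := leqP (rk (zset v setT y) + 2) (rk setT).
  have [|y1 [y2 [c1 [c2 [h1 h2 p1 p2 [c1_gt0 c2_gt0 ->]]]]]] := split_point _ le.
    by move=> i _; apply: y_ge0.
  have h1' i : 0 <= dot y1 i by apply: h1; rewrite inE.
  have h2' i : 0 <= dot y2 i by apply: h2; rewrite inE.
  have lt1 := rk_proper fs (fz _ y_ge0) (fz _ h1') p1.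
  have lt2 := rk_proper fs (fz _ y_ge0) (fz _ h2') p2.
  rewrite evD !evZ addr_ge0 // mulr_ge0 ?(ltW c1_gt0) ?(ltW c2_gt0) //; apply: IH => //; slia.
have [e|ne] := eqVneq (zset v setT y) setT.
  by apply: IH => //; rewrite e subnn.
have lt := rk_proper fs (fz _ y_ge0) (cface_setT v) (ltac:(by rewrite properT)).
have fJ : zset v setT y \in facets by rewrite inE fz //=; apply/eqP; slia.
pose J : facet := exist (fun J => J \in facets) _ fJ.
have [c c0 hc] := @facet_normal_unique J y y_ge0 erefl.
rewrite (_ : ev x y = c * ev x (a J)); first by rewrite mulr_ge0 // ltW.
by rewrite -evZ; apply: eq_bigr => i _; rewrite hc dotZ.
Qed.

(** A row of the slack matrix: a normal is recorded by its values on all points, which identifies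
    functionals that agree on the configuration. *)
Definition dual_conf (J : facet) : 'rV[R]_#|T| := \row_t dot (a J) (enum_val t).

Local Notation v' := dual_conf.
Local Notation rk' := (vrk v').
Local Notation cface' := (vface v').

Lemma dot_dual x (J : facet) : vdot v' x J = ev (fun i => x (enum_rank i) 0) (a J).
Proof.
rewrite /vdot mxE /ev (reindex enum_rank) /=; last exact/onW_bij/enum_rank_bij.
by apply: eq_bigr => i _; rewrite !mxE enum_rankK mulrC.
Qed.

Lemma dual_normalized (J : facet) : vdot v' (const_mx 1) J = 1.
Proof. by rewrite dot_dual /ev -[RHS](sum_a J); apply: eq_bigr => i _; rewrite mxE mul1r. Qed.

Definition above I := [set J : facet | I \subset val J].

(** The witness is the indicator of [I]: the sum over [I] of the nonnegative values of a normal is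
    zero exactly when the facet contains [I]. *)
Lemma cface_above I : cface' (above I).
Proof.
pose x : 'cV[R]_#|T| := \col_t (enum_val t \in I)%:R.
have ex (J : facet) : vdot v' x J = \sum_(i in I) dot (a J) i.
  rewrite dot_dual [RHS]big_mkcond; apply: eq_bigr => i _; rewrite mxE enum_rankK.
  by case: (i \in I); rewrite ?mul1r ?mul0r.
apply/cfaceP; exists x => [J|]; first by rewrite ex sumr_ge0.
apply/setP => J; rewrite in_zset !inE ex /=; apply/subsetP/eqP => [h|h i iI].
  by rewrite big1 // => i /h; rewrite mem_facet => /eqP.
by rewrite mem_facet (psumr_eq0P _ h iI).
Qed.

Lemma aboveS I J : I \subset J -> above J \subset above I.
Proof. by move=> s; apply/subsetP => K; rewrite !inE; apply: subset_trans. Qed.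

(** By [coatom_avoiding], a face is the intersection of the facets containing it. *)
Lemma above_sub I J : cface I -> (above I \subset above J) = (J \subset I).
Proof.
move=> fI; apply/idP/idP => [s|]; last exact: aboveS.
apply/subsetP => j jJ; apply: contraT => jI.
have [G] := coatom_avoiding fs fI (cface_setT v) (subsetT I) (in_setT j) jI.
rewrite inE => /and4P[fG IG _ /eqP rG] jG.
have pI : I \proper setT by apply/properP; split; [exact: subsetT | exists j].
have lt := rk_proper fs fI (cface_setT v) pI.
have GF : G \in facets by rewrite inE fG rG /=; apply/eqP; slia.
have : (exist (fun J => J \in facets) G GF) \in above I by rewrite inE.
by move/(subsetP s); rewrite inE => /subsetP/(_ _ jJ) /=; rewrite (negPf jG).
Qed.

Lemma above_inj : {in cface &, injective above}.
Proof.
move=> I J fI fJ e; apply/eqP; rewrite eqEsubset.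
by rewrite -above_sub // -[X in _ && X]above_sub // e subxx.
Qed.

(** Take the zero set of the sum [y] of the normals in [Z]. If a facet [J] contains it,
    [y - e *: a J] stays nonnegative for small [e]. Since [x] vanishes at [y], it is nonpositive at
    [a J], so [J] belongs to [Z]. *)
Lemma above_surj Z : cface' Z -> exists2 I, cface I & Z = above I.
Proof.
move=> /cfaceP[x x0 eZ]; pose y := \sum_(J in Z) a J.
have dy i : dot y i = \sum_(J in Z) dot (a J) i.
  by rewrite /vdot /y mulmx_sumr summxE.
have y_ge0 i : 0 <= dot y i by rewrite dy sumr_ge0.
have evy : ev (fun i => x (enum_rank i) 0) y = 0.
  rewrite /ev; under eq_bigr do rewrite dy mulr_sumr.
  rewrite exchange_big big1 // => J; rewrite eZ in_zset => /andP[_ /eqP e].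
  by rewrite -[RHS]e dot_dual.
exists (zset v setT y); first by apply: cface_zset => //; apply: cface_setT.
apply/setP => J; rewrite inE; apply/idP/subsetP => [JZ i|h].
  rewrite in_zset inE dy mem_facet /= => /eqP /psumr_eq0P -> //.
have [e e0 he] := small_perturbation (dot y) (dot (- a J)).
have : 0 <= ev (fun i => x (enum_rank i) 0) (y - e *: a J).
  apply: facet_normals_generate => [K|i]; first by rewrite -dot_dual.
  have [|yi] := ltP 0 (dot y i).
    by move=> /he/ltW; rewrite !dotE mulrN.
  have yi0 : dot y i = 0 by apply/le_anti; rewrite yi y_ge0.
  have := h i; rewrite in_zset inE yi0 eqxx mem_facet => /(_ isT)/eqP e1.
  by rewrite !dotE yi0 e1 mulr0 subr0.
rewrite -scaleN1r evD !evZ evy -dot_dual add0r mulN1r oppr_ge0 pmulr_rle0 // => le.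
by rewrite eZ in_zset inE /= eq_le le x0.
Qed.

(** The slack matrix factors through the matrix [W] of all the vectors. *)
Lemma rk_dual_le : (rk' setT <= rk setT)%N.
Proof.
pose W : 'M[R]_(#|T|, n) := \matrix_t v (enum_val t).
apply: (@leq_trans (\rank W)).
  rewrite -mxrank_tr; apply: mxrankS; apply: span_min => J _.
  rewrite (_ : v' J = (a J)^T *m W^T) ?submxMl //.
  rewrite -trmx_mul; apply/rowP => t; rewrite !mxE /vdot mxE.
  by apply: eq_bigr => k _; rewrite mxE.
by apply: mxrankS; apply/row_subP => t; rewrite rowK sub_span ?inE.
Qed.

(** [above] strictly reverses inclusions. Chains from [I] to the top bound the dual rank from below;
    chains from the empty face to [I], with [rk_dual_le], bound it from above. *)
Lemma rk_above I : cface I -> rk' (above I) = (rk setT - rk I)%N.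
Proof.
move=> fI; have anti K L : cface K -> cface L -> K \proper L -> (rk' (above L) < rk' (above K))%N.
  move=> fK fL /properP[s [l lL lK]].
  apply: (rk_proper (face_system_cface v')); [exact: cface_above | exact: cface_above |].
  by rewrite properE aboveS // above_sub //; apply/subsetPn; exists l.
have f0 := cface_set0 y0_1; have fT := cface_setT v.
have := strictly_antitone_rk fs fI fT (subsetT I) anti.
have := strictly_antitone_rk fs f0 fI (sub0set I) anti.
rewrite rk_set0 subn0.
have := leq_trans (rkS v' (subsetT (above set0))) rk_dual_le.
have := rk_sub fs fI fT (subsetT I).
by move: (rk' _) (rk' _) (rk' _) (rk I) (rk setT) => *; slia.
Qed.

Lemma card_cfaces_dual d k : rk setT = d.+1 -> (k < d)%N ->
  #|cfaces v' (d - k.+1)| = #|cfaces v k|.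
Proof.
move=> rT kd; rewrite -(card_in_imset (f := above) (D := mem (cfaces v k))).
  apply: eq_card => Z; apply/idP/imsetP => [|[I]].
    rewrite inE => /andP[/above_surj[I fI ->]]; rewrite rk_above // rT => /eqP r.
    by exists I => //; rewrite inE fI /=; apply/eqP; slia.
  rewrite !inE => /andP[fI /eqP rI] ->; rewrite cface_above rk_above // rT rI /=.
  by apply/eqP; slia.
move=> I J; rewrite !inE => /andP[fI _] /andP[fJ _]; exact: above_inj.
Qed.

Lemma card_interval_dual d J : rk setT = d.+1 -> cface J -> (0 < d)%N ->
  #|interval cface' rk' (above J) setT d| = #|itv set0 J 1|.
Proof.
move=> rT fJ d0; rewrite -(card_in_imset (f := above) (D := mem (itv set0 J 1))).
  apply: eq_card => Z; apply/idP/imsetP => [|[I]].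
    rewrite inE => /and4P[/above_surj[I fI ->]]; rewrite above_sub // rk_above // rT => s _ /eqP r.
    by exists I => //; rewrite inE fI s sub0set /=; apply/eqP; slia.
  rewrite !inE => /and4P[fI _ s /eqP rI] ->; rewrite cface_above rk_above // rT rI.
  rewrite above_sub // s subsetT /=.
  by apply/eqP; slia.
move=> I K; rewrite !inE => /and4P[fI _ _ _] /and4P[fK _ _ _]; exact: above_inj.
Qed.

End Duality.

Theorem cofaces_bound (R : realFieldType) n (T : finType) (v : T -> 'rV[R]_n) y0 d k :
  (forall i, vdot v y0 i = 1) -> vrk v setT = d.+1 -> (k < d)%N ->
  let B := ('C(uphalf d, d - k.+1) + 'C(d./2, d - k.+1))%N in
  (#|cfaces v d.-1| * B <= 2 * #|cfaces v k|)%N /\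
  ((#|cfaces v d.-1| * B = 2 * #|cfaces v k|)%N <->
    k.+1 = d \/ k.+2 = d /\ forall J, J \in cfaces v d.-1 ->
      #|interval (vface v) (vrk v) set0 J 1| = d).
Proof.
move=> hy rT kd B; have [a ha] := exists_facet_normals v.
have a_ge0 J i : 0 <= vdot v (a J) i by have [] := ha J.
have zset_a J : val J = zset v setT (a J) by have [] := ha J.
have sum_a J : \sum_i vdot v (a J) i = 1 by have [] := ha J.
have rT' : vrk (dual_conf a) setT = d.+1.
  have -> : setT = above v set0 by apply/setP => J; rewrite !inE sub0set.
  by rewrite (rk_above hy a_ge0 zset_a) ?rk_set0 ?subn0 //; apply: cface_set0 hy.
have d0 : (0 < d)%N by slia.
(* Duality exchanges the dimensions [k] and [d - k.+1]. Writing 0 as [d - d.-1.+1] turns the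
   vertices of the dual into facets. *)
have := cfaces_bound (dual_normalized sum_a) rT' (k := d - k.+1).
have card_dual := card_cfaces_dual hy a_ge0 zset_a rT.
rewrite card_dual // (_ : 0 = d - d.-1.+1)%N; last by slia.
rewrite card_dual; last by slia.
case=> [|le eq]; first by slia.
split=> //; split=> [/eq[e|[e h]]|h].
- by left; slia.
- right; split; first by slia.
  move=> J JF; move: (JF); rewrite inE => /andP[fJ /eqP rJ].
  rewrite -(card_interval_dual hy a_ge0 zset_a rT) //; apply: h.
  rewrite inE cface_above // (rk_above hy a_ge0 zset_a) // rT rJ.
  by apply/eqP; slia.
- apply/eq; case: h => [e|[e h]]; first by left; slia.
  right; split=> [|Z]; first by slia.
  rewrite inE => /andP[/(above_surj a_ge0 zset_a)[J fJ ->]].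
  rewrite (rk_above hy a_ge0 zset_a) // => /eqP rJ.
  rewrite (card_interval_dual hy a_ge0 zset_a rT) //; apply: h.
  by rewrite inE fJ /=; apply/eqP; slia.
Qed.

(** * Polytopes *)

(* Imported only now: [set0], [setT] and [inE] shadow those of [finset]. *)
From mathcomp Require Import finmap classical_sets cardinality reals.
From mathcomp Require Import interval_inference convex.
Local Open Scope classical_set_scope.

Lemma vspace_row_basis (F : fieldType) n (U : {vspace 'rV[F]_n}) :
  exists2 B : 'M[F]_(\dim U, n), row_free B & forall u, (u \in U) = (u <= B)%MS.
Proof.
pose B := \matrix_(i < \dim U) (vbasis U)`_i.
have lin c : c *m B = \sum_i c 0 i *: (vbasis U)`_i.
  by rewrite mulmx_sum_row; apply: eq_bigr => i _; rewrite rowK.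
exists B => [|u].
  have /freeP hfree := basis_free (vbasisP U).
  by apply: inj_row_free => c; rewrite lin => h; apply/rowP => i; rewrite (hfree _ h) mxE.
apply/idP/submxP => [uU|[c ->]].
  exists (\row_i coord (vbasis U) i u); rewrite lin [LHS](coord_vbasis uU).
  by apply: eq_bigr => i _; rewrite mxE.
rewrite lin; apply: memv_suml => i _; apply/memvZ/vbasis_mem.
by rewrite mem_nth // size_tuple.
Qed.

(** * Convex hulls of finite families and their homogenisation *)

Section Hull.
Variables (R : realType) (n : nat) (T : finType) (p : T -> 'rV[R]_n).
Implicit Types (x : 'rV[R]_n) (I J X : {set T}) (w : T -> R) (y : 'cV[R]_(n + 1)).

Definition hom x : 'rV[R]_(n + 1) := row_mx x 1%:M.

Definition hconf i := hom (p i).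

Definition weights I w := [/\ forall i, 0 <= w i, forall i, i \notin I -> w i = 0 & \sum_i w i = 1].

Definition hull I : set 'rV[R]_n := [set x | exists2 w, weights I w & x = \sum_i w i *: p i].

Lemma hom_inj : injective hom.
Proof. by move=> x x' /eq_row_mx[]. Qed.

Lemma hom_affine t x x' : hom (t *: x + (1 - t) *: x') = t *: hom x + (1 - t) *: hom x'.
Proof.
rewrite /hom !scale_row_mx add_row_mx; congr row_mx.
by rewrite -scalerDl addrC subrK scale1r.
Qed.

Lemma hom_sum (S : finType) (q : S -> 'rV[R]_n) (w : S -> R) : \sum_i w i = 1 ->
  hom (\sum_i w i *: q i) = \sum_i w i *: hom (q i).
Proof.
rewrite /hom => w1; apply/rowP => j; rewrite summxE -(splitK j); case: (split j) => k /=.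
  rewrite row_mxEl summxE; by apply: eq_bigr => i _; rewrite [LHS]mxE [RHS]mxE row_mxEl.
transitivity (\sum_i w i); first by rewrite row_mxEr (ord1 k) mxE eqxx w1.
by apply: eq_bigr => i _; rewrite [RHS]mxE row_mxEr (ord1 k) mxE eqxx mulr1.
Qed.

Lemma hom_mul w y : \sum_i w i = 1 ->
  (hom (\sum_i w i *: p i) *m y) 0 0 = \sum_i w i * vdot hconf y i.
Proof.
move=> w1; rewrite hom_sum // mulmx_suml summxE.
by apply: eq_bigr => i _; rewrite -scalemxAl mxE.
Qed.

Definition y_one : 'cV[R]_(n + 1) := col_mx 0 1%:M.

Lemma hom_one x : (hom x *m y_one) 0 0 = 1.
Proof. by rewrite mul_row_col mulmx0 mul1mx add0r mxE. Qed.

Lemma dot_one i : vdot hconf y_one i = 1.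
Proof. exact: hom_one. Qed.

Lemma hull_point I i : i \in I -> hull I (p i).
Proof.
move=> iI; exists (fun j => (j == i)%:R).
  split=> [j|j jI|]; first by rewrite ler0n.
    by case: eqP jI => // ->; rewrite iI.
  by rewrite (bigD1 i) //= eqxx big1 ?addr0 // => j /negPf ->.
by rewrite (bigD1 i) //= eqxx scale1r big1 ?addr0 // => j /negPf ->; rewrite scale0r.
Qed.

Lemma hull_mono I J : I \subset J -> hull I `<=` hull J.
Proof.
move=> s x [w [w0 wI w1] ->]; exists w => //; split=> // i iJ.
by apply: wI; apply: contra iJ; apply: (fintype.subsetP s).
Qed.

Lemma conv_rV (l : {i01 R}) x x' : conv l (x : convex_lmodType 'rV[R]_n) x' =
  l%:num *: x + (1 - l%:num) *: x'.
Proof. by []. Qed.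

Lemma hull_convex I : @convex_set R 'rV[R]_n (hull I).
Proof.
move=> x x' l; rewrite !inE => -[w [w0 wI w1] ->] [w' [w0' wI' w1'] ->].
have l0 : 0 <= l%:num by apply: ge0.
have l1 : 0 <= 1 - l%:num by rewrite subr_ge0; apply: le1.
exists (fun i => l%:num * w i + (1 - l%:num) * w' i).
  split=> [i|i iI|]; first by rewrite addr_ge0 ?mulr_ge0.
    by rewrite wI // wI' // !mulr0 addr0.
  by rewrite big_split /= -!mulr_sumr w1 w1'; ring.
rewrite conv_rV !scaler_sumr -big_split /=; apply: eq_bigr => i _.
by rewrite !scalerA -scalerDl.
Qed.

(** Induct on the size of [I]: split off a point of nonzero weight and divide the other weights by
    [1 - w i]. Weight 1 is a separate case. *)
Lemma hull_sub_convex (A : set 'rV[R]_n) I : @convex_set R 'rV[R]_n A ->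
  (forall i, i \in I -> A (p i)) -> hull I `<=` A.
Proof.
move=> cA; move: {2}#|I| (erefl #|I|) => m; elim: m I => [|m IH] I hI AI x [w [w0 wI w1] ->].
  have e : I = finset.set0 by apply/eqP; rewrite -cards_eq0 hI.
  have := oner_neq0 R; rewrite -w1 big1 ?eqxx // => i _; apply: wI.
  by rewrite e finset.inE.
have [i iI wi] : exists2 i, i \in I & w i != 0.
  apply/exists_inP; rewrite -[X in is_true X]negbK negb_exists_in; apply/negP => /forall_inP h.
  have := oner_neq0 R; rewrite -w1 big1 ?eqxx // => i _.
  have [iI|] := boolP (i \in I); last exact: wI.
  by apply/eqP/negPn/h.
have wi_gt0 : 0 < w i by rewrite lt0r wi w0.
have [e|ne] := eqVneq (w i) 1.
  rewrite (bigD1 i) //= e scale1r big1 ?addr0; first exact: AI.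
  have : \sum_(j | j != i) w j = 0.
    by move: w1; rewrite (bigD1 i) //= e => /(canRL (addKr _)); rewrite addNr.
  by move=> /psumr_eq0P h j ji; rewrite h ?scale0r.
have s : 0 < 1 - w i.
  rewrite lt0r subr_eq0 eq_sym ne subr_ge0 -w1 (bigD1 i) //= lerDl.
  by apply: sumr_ge0 => j _.
have wi1 : w i <= 1 by rewrite -subr_ge0 ltW.
pose w' j := if j == i then 0 else w j / (1 - w i).
have Ax' : A (\sum_j w' j *: p j).
  apply: (IH (I :\ i)%SET).
  - by move: hI; rewrite (cardsD1 i) iI add1n => -[].
  - by move=> j; rewrite in_setD1 => /andP[_ /AI].
  exists w' => //; split=> [j|j|]; rewrite /w'.
  - by case: eqP => // _; rewrite divr_ge0 // ltW.
  - rewrite in_setD1; case: eqP => //= _ /wI ->; by rewrite mul0r.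
  rewrite (bigD1 i) //= eqxx add0r.
  rewrite (eq_bigr (fun j => w j / (1 - w i))); last by move=> j /negPf ->.
  rewrite -mulr_suml -w1 [in X in _ / X](bigD1 i) //= addrAC subrr add0r divff //.
  by apply/eqP => e; move: s; rewrite -w1 (bigD1 i) //= addrAC subrr add0r e ltxx.
have := cA (p i) (\sum_j w' j *: p j) (Itv01 (w0 i) wi1).
rewrite !inE => /(_ (AI i iI) Ax'); congr A.
rewrite conv_rV /= (bigD1 i) //= [in RHS](bigD1 i) //=; congr (_ + _).
rewrite {1}/w' eqxx scale0r add0r scaler_sumr; apply: eq_bigr => j /negPf ji.
by rewrite /w' ji scalerA mulrC divfK // gt_eqF.
Qed.

Lemma convex_hull_points I : convex_hull (p @` [set` I]) = hull I.
Proof.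
apply/seteqP; split.
  by apply: smallest_sub; [apply: hull_convex | move=> _ [i iI <-]; apply: hull_point].
apply: hull_sub_convex.
  move=> x x' l; rewrite !inE => hx hx' A [cA pA].
  have := cA x x' l; rewrite !inE; apply; [exact: hx | exact: hx'].
by move=> i iI A [_]; apply; exists i.
Qed.

Lemma sum_weights_eq0 I w y : weights I w -> (forall i, 0 <= vdot hconf y i) ->
  (\sum_i w i * vdot hconf y i = 0) <-> weights (I :&: zset hconf finset.setT y)%SET w.
Proof.
move=> [w0 wI w1] y0; split=> [e|[_ h _]].
  split=> // i; rewrite finset.in_setI negb_and => /orP[/wI//|].
  rewrite in_zset finset.inE /= => ne.
  have := psumr_eq0P (fun i _ => mulr_ge0 (w0 i) (y0 i)) e (i := i) isT.
  by move/eqP; rewrite mulf_eq0 (negPf ne) orbF => /eqP.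
rewrite big1 // => i _.
have [|/h->] := boolP (i \in (I :&: zset hconf finset.setT y)%SET); last by rewrite mul0r.
by rewrite finset.in_setI in_zset => /and3P[_ _ /eqP->]; rewrite mulr0.
Qed.

Lemma hull_zset J y : (forall i, 0 <= vdot hconf y i) ->
  hull J `&` [set x | (hom x *m y) 0 0 = 0] = hull (J :&: zset hconf finset.setT y)%SET.
Proof.
move=> y0; apply/seteqP; split=> x.
  move=> [[w hw ->] /=]; rewrite hom_mul; last by have [] := hw.
  by move=> /(sum_weights_eq0 hw y0) h; exists w.
move=> [w hw ->]; have hw' : weights J w.
  have [h1 h2 h3] := hw; split=> // i iJ; apply: h2.
  by rewrite finset.in_setI (negPf iJ).
split; first by exists w.
rewrite /= hom_mul; last by have [] := hw.
by apply/(sum_weights_eq0 hw' y0).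
Qed.

Lemma face_hullP F : face (hull finset.setT) F <-> exists2 I, vface hconf I & F = hull I.
Proof.
split=> [[c [b [hP ->]]]|[I /cfaceP[y y0 ->] ->]].
  (* The value of [y] at [hom x] is the slack of the inequality [x *m c <= b]. *)
  pose y : 'cV[R]_(n + 1) := col_mx (- c) b%:M.
  have hy x : (hom x *m y) 0 0 = b - (x *m c) 0 0.
    by rewrite mul_row_col mul1mx mulmxN !mxE eqxx mulr1n addrC.
  have y0 i : 0 <= vdot hconf y i.
    by rewrite /vdot hy subr_ge0; apply/hP/hull_point; rewrite finset.inE.
  exists (zset hconf finset.setT y); first by apply: cface_zset => //; apply: cface_setT.
  rewrite -[in RHS](finset.setTI (zset _ _ _)) -hull_zset //; congr (_ `&` _).
  apply/seteqP; split=> x /=; rewrite hy => /eqP.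
    by move=> /eqP ->; rewrite subrr.
  by rewrite subr_eq0 => /eqP ->.
exists (- usubmx y), (dsubmx y 0 0).
have hy x : (x *m - usubmx y) 0 0 = dsubmx y 0 0 - (hom x *m y) 0 0.
  rewrite -[in hom x *m y](vsubmxK y) mul_row_col mul1mx mulmxN !mxE; ring.
split=> [x [w [w0 _ w1] ->]|].
  rewrite hy gerBl hom_mul //; apply: sumr_ge0 => i _; exact: mulr_ge0.
rewrite -[in LHS](finset.setTI (zset _ _ _)) -hull_zset //; congr (_ `&` _).
apply/seteqP; split=> x /=; rewrite hy => /eqP.
  by move=> /eqP ->; rewrite subr0.
by rewrite subr_eq addrC -subr_eq subrr eq_sym => /eqP.
Qed.

Lemma mem_hull_point I i : vface hconf I -> hull I (p i) -> i \in I.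
Proof.
move=> /cfaceP[y y0 eI]; rewrite eI -[zset _ _ _]finset.setTI -hull_zset // => -[_ /= e].
by rewrite finset.in_setI in_zset !finset.inE /= /vdot e eqxx.
Qed.

Lemma hull_subset I J : vface hconf J -> (hull I `<=` hull J) <-> I \subset J.
Proof.
move=> fJ; split=> [s|]; last exact: hull_mono.
by apply/fintype.subsetP => i iI; apply: mem_hull_point fJ _; apply/s/hull_point.
Qed.

Lemma hull_inj : {in vface hconf &, injective hull}.
Proof.
move=> I J fI fJ e; apply/eqP; rewrite finset.eqEsubset.
by apply/andP; split; apply/hull_subset => //; rewrite e.
Qed.

Lemma affine_hull_sub I m (M : 'M[R]_(m, n + 1)) : (forall i, i \in I -> (hconf i <= M)%MS) ->
  affine_hull (hull I) `<=` [set x | (hom x <= M)%MS].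
Proof.
move=> h; apply: smallest_sub => [x x' t /= hx hx'|x [w [_ wI w1] ->] /=].
  by rewrite hom_affine addmx_sub ?scalemx_sub.
rewrite hom_sum //; apply: summx_sub => i _.
by have [/h|/wI->] := boolP (i \in I); [apply: scalemx_sub | rewrite scale0r sub0mx].
Qed.

(** The affine hull [x + U] homogenises to the span of [hom x] and of [U] at height zero, whose rank
    is one more than the dimension of [U]. *)
Lemma rk_has_dim I k : has_dim (hull I) k -> vrk hconf I = k.+1.
Proof.
move=> [x [U [dU eU]]]; have [B Bfree BU] := vspace_row_basis U.
have hullaff : hull I `<=` affine_hull (hull I) by apply: sub_gen_smallest.
have hom_add u : hom (x + u) = hom x + row_mx u 0 by rewrite /hom add_row_mx addr0.
pose N := col_mx (hom x) (row_mx B 0).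
have Nfree : row_free N.
  apply: inj_row_free => c; rewrite -[c]hsubmxK mul_row_col !mul_mx_row add_row_mx.
  rewrite mulmx0 addr0 mulmx1.
  rewrite -[RHS]row_mx0 => /eq_row_mx[+ e]; rewrite e mul0mx add0r -(mul0mx _ B).
  by move=> /(row_free_inj Bfree) ->; rewrite row_mx0.
have e : (span hconf I :=: N)%MS.
  apply/eqmxP/andP; split.
    apply: span_min => i iI; have := hullaff _ (hull_point iI).
    rewrite eU => -[u /=]; rewrite BU => /submxP[c ->] eu.
    rewrite /hconf -eu hom_add -addsmxE addmx_sub ?addsmxSl //.
    apply: submx_trans (addsmxSr _ _).
    by rewrite -[0](mulmx0 _ c) -mul_mx_row submxMl.
  have aff u : u \in U -> (hom (x + u) <= span hconf I)%MS.
    move=> uU; apply: (affine_hull_sub (fun i => @sub_span _ _ _ hconf I i)).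
    by rewrite eU; exists u.
  have homx : (hom x <= span hconf I)%MS by rewrite -[x]addr0 aff // mem0v.
  rewrite col_mx_sub homx /=; apply/row_subP => i; rewrite row_row_mx row0.
  rewrite -[row_mx _ _](addKr (hom x)) -hom_add addmx_sub ?eqmx_opp // aff //.
  by rewrite BU row_sub.
by rewrite /vrk e; move: Nfree; rewrite /row_free => /eqP ->; rewrite dU.
Qed.

(** Seen from its point [x], an affine set is a linear subspace: multiples lie on a line through
    [x], and a sum is the midpoint of the doubled vectors. *)
Lemma affine_set_shift_sum (S : Type) (A : set 'rV[R]_n) x (r : seq S)
    (c : S -> R) (f : S -> 'rV[R]_n) :
  affine_set A -> A x -> (forall i, A (x + f i)) -> A (x + \sum_(i <- r) c i *: f i).
Proof.
move=> aA Ax h; have hZ t u : A (x + u) -> A (x + t *: u).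
  move=> Au; have := aA _ _ t Au Ax; congr A.
  by rewrite scalerDr scalerBl scale1r addrAC addrCA subrr addr0 addrC.
have hD u u' : A (x + u) -> A (x + u') -> A (x + (u + u')).
  move=> Au Au'; have := aA _ _ 2^-1 (hZ 2 _ Au) (hZ 2 _ Au'); congr A.
  by apply/rowP => j; rewrite !mxE; field.
elim: r => [|i r IH]; first by rewrite big_nil addr0.
by rewrite big_cons; apply: hD => //; apply: hZ.
Qed.

Lemma has_dim_rk I k : vrk hconf I = k.+1 -> has_dim (hull I) k.
Proof.
move=> rI; have [i0 i0I] : exists i, i \in I by apply: (@rk_gt0 _ _ _ hconf); rewrite rI.
pose s := [seq p i - p i0 | i <- enum I]; pose U := <<s>>%VS.
suff eU : affine_hull (hull I) = [set p i0 + u | u in [set` U]].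
  have h : has_dim (hull I) (\dim U) by exists (p i0), U.
  by have := rk_has_dim h; rewrite rI => -[->].
apply/seteqP; split.
  apply: smallest_sub => [_ _ t [u uU <-] [u' uU' <-]|x [w [_ wI w1] ->]].
    exists (t *: u + (1 - t) *: u'); first by rewrite /= memvD ?memvZ.
    by apply/rowP => j; rewrite !mxE; ring.
  exists (\sum_i w i *: (p i - p i0)); last first.
    rewrite (eq_bigr (fun i => w i *: p i - w i *: p i0)); last by move=> i _; rewrite scalerBr.
    by rewrite big_split /= sumrN -scaler_suml w1 scale1r addrCA subrr addr0.
  apply: memv_suml => i _; have [iI|/wI->] := boolP (i \in I); last by rewrite scale0r mem0v.
  by apply/memvZ/memv_span/mapP; exists i => //; rewrite mem_enum.
move=> _ [u uU <-] A [aA hA].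
have /coord_span -> : u \in <<in_tuple s>>%VS by [].
apply: affine_set_shift_sum => //; first exact/hA/hull_point.
move=> j; have /mapP[i iI ->] : (in_tuple s)`_j \in s by rewrite mem_nth.
by rewrite addrC subrK; apply/hA/hull_point; rewrite -mem_enum.
Qed.
End Hull.

(** * Faces, simplicity and simpliciality read off the configuration *)

Section FaceTransport.
Variables (R : realType) (n : nat) (T : finType) (p : T -> 'rV[R]_n).
Implicit Types (x : 'rV[R]_n) (I J X : {set T}) (y : 'cV[R]_(n + 1)).

Local Notation v := (hconf p).
Local Notation itv := (interval (vface v) (vrk v)).
Local Notation P := (hull p finset.setT).

Lemma faces_hullE k : faces P k = hull p @` [set` cfaces v k].
Proof.
apply/seteqP; split=> [F [/face_hullP[I fI ->] /rk_has_dim rI]|_ [I /= + <-]].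
  by exists I => //; rewrite /= finset.inE fI rI /=.
rewrite finset.inE => /andP[fI /eqP rI]; split; last exact: has_dim_rk.
by apply/face_hullP; exists I.
Qed.

Lemma card_hull_image (S : {set {set T}}) : {in S, forall I, vface v I} ->
  #|` fset_set (hull p @` [set` S])|%fset = #|S|.
Proof.
move=> fS; have u : uniq [seq hull p L | L <- enum S].
  rewrite map_inj_in_uniq ?enum_uniq // => I J; rewrite !mem_enum => /fS fI /fS fJ.
  exact: hull_inj.
have -> : hull p @` [set` S] = [set` [fset F | F in [seq hull p L | L <- enum S]]%fset].
  apply/seteqP; split=> [_ [I /= IS <-]|F]; rewrite /= !finmap.inE /=.
    by apply/mapP; exists I => //; rewrite mem_enum.
  by move=> /mapP[I IS ->]; exists I => //=; rewrite -mem_enum.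
by rewrite set_fsetK card_fseq undup_id // size_map -cardE.
Qed.

Lemma fnum_hull k : fnum P k = #|cfaces v k|.
Proof.
rewrite /fnum faces_hullE card_hull_image // => I.
by rewrite finset.inE => /andP[].
Qed.

Lemma simple_hull d : (0 < d)%N ->
  simple d P <-> forall X, X \in cfaces v 0 -> #|itv X finset.setT d| = d.
Proof.
move=> d0.
have E X : X \in cfaces v 0 ->
    #|` fset_set [set G | faces P d.-1 G /\ hull p X `<=` G]%classic|%fset = #|itv X finset.setT d|.
  rewrite finset.inE => /andP[fX _]; rewrite -card_hull_image; last first.
    by move=> I; rewrite finset.inE => /andP[].
  congr (#|` fset_set _|%fset); rewrite faces_hullE; apply/seteqP.
  split=> [G [[I /= + <-] XI]|_ [I /= + <-]].
    rewrite finset.inE prednK // => /andP[fI rI]; exists I => //=.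
    by rewrite finset.inE fI rI finset.subsetT /= andbT; apply/(hull_subset _ fI).
  rewrite finset.inE => /and4P[fI XI _ rI]; split; last exact: hull_mono.
  by exists I => //=; rewrite finset.inE fI prednK.
split=> [sP X X0|h F]; first by rewrite -E //; apply: sP; rewrite faces_hullE; exists X.
by rewrite faces_hullE => -[X /= X0 <-]; rewrite E // h.
Qed.

Lemma vertex_point_eq X i j : vrk v X = 1%N -> i \in X -> j \in X -> p i = p j.
Proof. by move=> rX iX jX; apply: hom_inj; apply: (vertex_eq (dot_one p) rX iX jX). Qed.

Lemma hull_vertex X i x : vrk v X = 1%N -> i \in X -> hull p X x -> x = p i.
Proof.
move=> rX iX [w [_ wX w1] ->]; rewrite -[RHS]scale1r -w1 scaler_suml.
apply: eq_bigr => j _; have [jX|/wX->] := boolP (j \in X); last by rewrite !scale0r.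
by rewrite (vertex_point_eq rX jX iX).
Qed.

Lemma range_hull (S : finType) (q : S -> 'rV[R]_n) : convex_hull (range q) = hull q finset.setT.
Proof.
rewrite -convex_hull_points; congr convex_hull; apply/seteqP; split=> _ [i _ <-].
  by exists i => //=; rewrite finset.inE.
by exists i.
Qed.

Lemma hull_nonneg I x y : {in I, forall i, 0 <= vdot v y i} -> hull p I x -> 0 <= (hom x *m y) 0 0.
Proof.
move=> y0 [w [w0 wI w1] ->]; rewrite hom_mul //; apply: sumr_ge0 => i _.
by have [iI|/wI->] := boolP (i \in I); [rewrite mulr_ge0 // y0 | rewrite mul0r].
Qed.

(** An affine relation is a linear relation between homogenised points, whose last coordinate is the
    sum of the coefficients. *)
Lemma affinely_independent_row_free m (q : 'I_m -> 'rV[R]_n) :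
  affinely_independent q <-> row_free (\matrix_i hom (q i)).
Proof.
have e w : \row_i w i *m (\matrix_i hom (q i)) = row_mx (\sum_i w i *: q i) (\sum_i w i)%:M.
  rewrite mulmx_sum_row; apply/rowP => j; rewrite summxE -(splitK j).
  case: (split j) => k /=.
    rewrite row_mxEl summxE; apply: eq_bigr => i _.
    by rewrite rowK [LHS]mxE row_mxEl mxE [RHS]mxE.
  rewrite row_mxEr (ord1 k) mxE eqxx mulr1n; apply: eq_bigr => i _.
  by rewrite rowK [LHS]mxE row_mxEr mxE mxE eqxx mulr1.
split=> [h|h w w1 wq i].
  apply: inj_row_free => c; have -> : c = \row_i c 0 i by apply/rowP => i; rewrite mxE.
  rewrite e -[RHS]row_mx0 => /eq_row_mx[hq h1]; apply/rowP => i; rewrite !mxE; apply: h => //.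
  by move/matrixP/(_ 0 0): h1; rewrite !mxE eqxx.
have : \row_i w i = 0.
  by apply: (row_free_inj h); rewrite e w1 wq mul0mx raddf0 row_mx0.
by move/rowP/(_ i); rewrite !mxE.
Qed.

(** Affine independence allows at most [d.+1] points [q j], and every vertex of [J] is one of them.
    The reverse bound is [interval_bin_le]. *)
Lemma simplex_vertices J d : vface v J -> vrk v J = d.+1 -> simplex (hull p J) ->
  #|itv finset.set0 J 1| = d.+1.
Proof.
move=> fJ rJ [m [q [/affinely_independent_row_free qfree eJ]]].
have hq : hull p J = hull q finset.setT by rewrite eJ range_hull.
have rq : vrk (hconf q) finset.setT = d.+1.
  by apply: rk_has_dim; rewrite -hq; apply: has_dim_rk.
have md : (m <= d.+1)%N.
  move: qfree; rewrite /row_free => /eqP <-; rewrite -rq; apply/mxrankS/row_subP => i.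
  by rewrite rowK; apply: (sub_span (hconf q)); rewrite finset.inE.
have qJ j : hull p J (q j) by rewrite hq; apply: hull_point; rewrite finset.inE.
apply/eqP; rewrite eqn_leq; apply/andP; split; last first.
  have f0 := cface_set0 (dot_one p).
  have := interval_bin_le (face_system_cface v) 1 f0 fJ (finset.sub0set _).
  by rewrite rk_set0 subn0 bin1 rJ.
apply: leq_trans md; rewrite -[leqRHS]card_ord -cardsT.
pose f (j : 'I_m) := [set i | p i == q j]%SET.
apply: leq_trans (leq_imset_card f _); apply/subset_leq_card/fintype.subsetP => X.
rewrite finset.inE => /and4P[fX _ XJ /eqP rX].
have [i iX] : exists i, i \in X by apply: (@rk_gt0 _ _ _ v); rewrite rX.
(* The vertex is a convex combination of the [q j]. A functional defining [X] vanishes at it, hence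
   at each [q j] of nonzero weight, which therefore lies in the hull of [X]. *)
have [j ej] : exists j, q j = p i.
  have := hull_point p (fintype.subsetP XJ _ iX); rewrite hq => -[w [w0 _ w1] ei].
  move: (fX) => /cfaceP[y y0 eX].
  have qy j : 0 <= vdot (hconf q) y j.
    by apply: (@hull_nonneg J) => // l _; apply: y0.
  have : \sum_j w j * vdot (hconf q) y j = 0.
    rewrite -hom_mul // -ei; move: iX; rewrite eX in_zset => /andP[_ /eqP]; exact.
  move=> /(psumr_eq0P (fun j _ => mulr_ge0 (w0 j) (qy j))) h.
  have [j wj] : exists j, w j != 0.
    apply/existsP; rewrite -[X in is_true X]negbK negb_exists; apply/negP => /forallP h0.
    by have := oner_neq0 R; rewrite -w1 big1 ?eqxx // => j _; apply/eqP/negPn/h0.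
  exists j; apply: (hull_vertex rX iX).
  have -> : X = (J :&: zset v finset.setT y)%SET by rewrite -eX; apply/esym/finset.setIidPr.
  rewrite -hull_zset //; split; first exact: qJ.
  by have /eqP := h j isT; rewrite mulf_eq0 (negPf wj) => /eqP.
apply/imsetP; exists j; first by rewrite finset.inE.
apply/finset.setP => l; rewrite finset.inE ej; apply/idP/eqP => [lX|e].
  exact: vertex_point_eq rX lX iX.
by apply: (eq_cface fX _ iX); rewrite /hconf e.
Qed.

(** A functional nonnegative at the vertices is nonnegative on [J]. Hence one representative per
    vertex spans [J], and the count makes these representatives independent. *)
Lemma simplex_of_vertices J : vface v J -> #|itv finset.set0 J 1| = vrk v J ->
  simplex (hull p J).
Proof.
move=> fJ; set A := itv _ _ _ => cA.
have AP X : X \in A -> [/\ vface v X, X \subset J & vrk v X = 1%N].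
  by rewrite finset.inE => /and4P[? _ ? /eqP].
have /choice[g hg] : forall j : 'I_#|A|, exists i, i \in enum_val j.
  move=> j; have [_ _ rX] := AP _ (enum_valP j).
  by apply: (@rk_gt0 _ _ _ v); rewrite rX.
pose Q := \matrix_j v (g j).
have posJ y : (forall j, 0 <= vdot v y (g j)) -> {in J, forall i, 0 <= vdot v y i}.
  move=> hy; apply: (nonneg_of_vertices (dot_one p) fJ) => X i XA iX.
  have [_ _ rX] := AP _ XA; have := hg (enum_rank_in XA X); rewrite enum_rankK_in // => gX.
  by rewrite /vdot (vertex_eq (dot_one p) rX iX gX); apply: hy.
have QJ : {in J, forall i, (v i <= Q)%MS}.
  move=> i iJ; apply: contraT => /not_submx_separation[z Qz zi].
  have z0 j : vdot v z (g j) = 0.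
    by apply: dot_submx0 Qz _; rewrite -[v _](rowK (fun j => v (g j))) row_sub.
  have h1 : 0 <= vdot v z i by apply: posJ => // j; rewrite z0.
  have h2 : 0 <= vdot v (- z) i by apply: posJ => // j; rewrite dotN z0 oppr0.
  rewrite dotN oppr_ge0 in h2; move: zi; rewrite -/(vdot v z i).
  by rewrite (le_anti (introT andP (conj h2 h1))) eqxx.
have Qfree : row_free Q.
  rewrite /row_free eqn_leq rank_leq_row /= [leqLHS]cA.
  by apply/mxrankS/span_min; apply: QJ.
pose q j := p (g j).
exists #|A|, q; split; first exact/affinely_independent_row_free.
have gJ j : g j \in J by have [_ /fintype.subsetP s _] := AP _ (enum_valP j); apply: s.
rewrite range_hull; apply/seteqP; split; last first.
  apply: hull_sub_convex => [|j _]; first exact: hull_convex.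
  exact: hull_point.
apply: hull_sub_convex => [|i iJ]; first exact: hull_convex.
have /row_freeP[B QB] := Qfree; have /submxP[c ec] := QJ _ iJ.
(* Column [j] of the right inverse [B] is a dual basis functional: its values on the representatives
   are 0 and 1, so it is nonnegative on [J]. *)
have c_ge0 j : 0 <= c 0 j.
  have cE : c = v i *m B by rewrite ec -mulmxA QB mulmx1.
  have -> : c 0 j = vdot v (col j B) i by rewrite cE /vdot colE mulmxA -colE [RHS]mxE.
  apply: (posJ _ _ _ iJ) => l; rewrite /vdot -[v (g l)](rowK (fun j => v (g j))) -/Q.
  by rewrite colE -row_mul mulmxA QB mul1mx !mxE ler0n.
have eq_hom : hom (p i) = \sum_j c 0 j *: hom (q j).
  by rewrite [LHS]ec mulmx_sum_row; apply: eq_bigr => j _; rewrite rowK.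
have c1 : \sum_j c 0 j = 1.
  rewrite -(hom_one (p i)) eq_hom mulmx_suml summxE; apply: eq_bigr => j _.
  by rewrite -scalemxAl mxE hom_one mulr1.
exists (fun j => c 0 j); last by apply: hom_inj; rewrite hom_sum.
by split=> // j; rewrite finset.inE.
Qed.

Lemma simplicial_hull d : (0 < d)%N ->
  simplicial d P <-> forall J, J \in cfaces v d.-1 -> #|itv finset.set0 J 1| = d.
Proof.
move=> d0; split=> [sP J JF|h G].
  move: (JF); rewrite finset.inE => /andP[fJ /eqP rJ].
  rewrite (simplex_vertices fJ rJ) ?prednK //; apply: sP.
  by rewrite faces_hullE; exists J.
rewrite faces_hullE => -[J /= JF <-]; move: (JF); rewrite finset.inE => /andP[fJ /eqP rJ].
by apply: simplex_of_vertices => //; rewrite h // rJ prednK.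
Qed.

End FaceTransport.

(** * Clearing denominators and conclusion *)

Lemma rho_ratio d k (X Y : nat) : (0 < Y)%N ->
  (rho d k <= X%:R / Y%:R) = (Y * ('C(uphalf d, k) + 'C(d./2, k)) <= 2 * X)%N /\
  (X%:R / Y%:R = rho d k <-> (Y * ('C(uphalf d, k) + 'C(d./2, k)) = 2 * X)%N).
Proof.
move=> Y0; have Y0' : 0 < Y%:R :> rat by rewrite ltr0n.
have e : rho d k * Y%:R * 2 = (Y * ('C(uphalf d, k) + 'C(d./2, k)))%:R.
  by rewrite /rho natrM natrD; field.
split.
  by rewrite ler_pdivlMr // -(ler_pM2r (x := 2)) // e -natrM ler_nat [(X * 2)%N]mulnC.
split=> [h|h].
  by apply/eqP; rewrite -(eqr_nat rat) -e -h divfK ?lt0r_neq0 // natrM mulrC.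
apply: (mulIf (lt0r_neq0 Y0')); rewrite divfK ?gt_eqF //.
by apply: (@mulIf _ 2) => //; rewrite e h natrM mulrC.
Qed.

Theorem theorem3p2 (R : realType) (n d k : nat) (P : set 'rV[R]_n)
    (hd : (1 <= d)%N) (hP : d_polytope d P) (hk : (k <= d - 1)%N) :
  [/\ (fnum P k)%:R / (fnum P 0)%:R >= rho d k,
      (fnum P k)%:R / (fnum P (d - 1))%:R >= rho d (d - k - 1),
      (fnum P k)%:R / (fnum P 0)%:R = rho d k <->
        k = 0%N \/ k = 1%N /\ simple d P
    & (fnum P k)%:R / (fnum P (d - 1))%:R = rho d (d - k - 1) <->
        k = (d - 1)%N \/ k.+2 = d /\ simplicial d P].
Proof.
have [[s eP] hdim] := hP.
pose p (i : 'I_(size s)) := s`_i.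
have eP' : P = hull p finset.setT.
  rewrite eP -range_hull; congr convex_hull; apply/seteqP; split=> [x /= xs|_ [i _ <-] /=].
    have lt : (index x s < size s)%N by rewrite index_mem.
    by exists (Ordinal lt) => //; rewrite /p /= nth_index.
  by rewrite mem_nth.
have one := dot_one p.
have rT : vrk (hconf p) finset.setT = d.+1 by apply: rk_has_dim; rewrite -eP'.
have kd : (k < d)%N by lia.
have pos j : (j < d.+1)%N -> (0 < #|cfaces (hconf p) j|)%N.
  by move=> jd; apply: (card_cfaces_gt0 one); rewrite rT.
have [le1 eq1] := cfaces_bound one rT kd.
have [le2 eq2] := cofaces_bound one rT kd.
have [r1 r1'] := rho_ratio d k #|cfaces (hconf p) k| (pos 0%N isT).
have pd : (d - 1 < d.+1)%N by lia.
have [r2 r2'] := rho_ratio d (d - k - 1) #|cfaces (hconf p) k| (pos _ pd).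
have ek : (d - k - 1 = d - k.+1)%N by lia.
have ed : (d - 1 = d.-1)%N by lia.
rewrite ek ed in r2 r2' *.
rewrite eP' !fnum_hull; split.
- by rewrite r1.
- by rewrite r2.
- by rewrite r1' eq1 -simple_hull.
- rewrite r2' eq2 -simplicial_hull //.
  by split=> -[e|?]; [left; lia | right | left; lia | right].
Qed.
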